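(* Let $G$ be a finite group. From the knowledge of $\Lambda^*(G)$ one may determine whether $G$ is soluble, whether $G$ is supersoluble and, for every prime power $n$, the number of maximal subgroups of $G$ of index $n$. That is, if $G$ and $H$ are finite groups with $\Lambda^*(G)=\Lambda^*(H)$, then $G$ is soluble if and only if $H$ is soluble, $G$ is supersoluble if and only if $H$ is supersoluble, and for every prime power $n$ the groups $G$ and $H$ have the same number of maximal subgroups of index $n$.
   Context: For a finite group $G$ and non-negative integers $a\leq b$, $\Gamma_{a,b}(G)$ is the undirected graph, possibly with loops, whose vertices are the elements of $G^a\cup G^b$ (a disjoint union if $a\neq b$, just $G^a$ if $a=b$; $G^0$ consists of the single empty tuple), in which $(x_1,\dots,x_a)\in G^a$ and $(y_1,\dots,y_b)\in G^b$ are adjacent if and only if $\langle x_1,\dots,x_a,y_1,\dots,y_b\rangle=G$. If $a\neq b$ there are no other edges; if $a=b$ there is a loop at $x\in G^a$ exactly when the entries of $x$ generate $G$. A vertex is isolated if it is adjacent to no vertex (itself included). $\Gamma^*_{a,b}(G)$ is obtained from $\Gamma_{a,b}(G)$ by deleting the isolated vertices. $\Lambda^*(G)$ is the collection of all the connected components of the graphs $\Gamma^*_{a,b}(G)$, for all non-negative integers $a\leq b$, regarded as abstract graphs (with their loops) up to isomorphism and counted with multiplicity; the labels $a,b$ from which each graph arises are not part of the data. Thus $\Lambda^*(G)=\Lambda^*(H)$ means that there is a bijection between the two collections matching isomorphic graphs. *)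

(* Defs.v *)
From HB Require Import structures.
From mathcomp Require Import all_boot all_fingroup all_solvable.

Set Implicit Arguments.
Unset Strict Implicit.
Unset Printing Implicit Defensive.

Local Open Scope group_scope.

(* Finite undirected graphs without multiple edges; loops are allowed, since
   [adj] is not assumed to be irreflexive. *)
Record loop_graph := LoopGraph {
  vert : finType;
  adj : rel vert;
  adj_sym : symmetric adj }.

Definition graph_iso (X Y : loop_graph) : Prop :=
  exists2 f : vert X -> vert Y,
    bijective f & forall x y, adj (f x) (f y) = adj x y.

Section Subgraphs.

Variable X : loop_graph.

Section Induced.

Variable S : {set vert X}.

Definition induced_adj : rel {x | x \in S} := fun x y => adj (val x) (val y).

Fact induced_adj_sym : symmetric induced_adj.
Proof. by move=> x y; apply: adj_sym. Qed.

Definition induced : loop_graph := LoopGraph induced_adj_sym.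

End Induced.

Definition isolated (x : vert X) : bool := [forall y, ~~ adj x y].

Definition delete_isolated : loop_graph := induced [set x | ~~ isolated x].

Definition components : {set {set vert X}} :=
  [set [set y | connect (@adj X) x y] | x in vert X].

End Subgraphs.

Section GeneratingGraphs.

Variables (gT : finGroupType) (G : {group gT}).

Section Gamma.

Variables a b : nat.

(* For a <= b, the vertices are the sequences over G of length a or b. When
   a <> b the length tells G^a and G^b apart, so this is their disjoint union;
   when a = b it is just G^a. *)
Definition Gamma_vert : finType :=
  {x : b.-bseq gT |
    ((size x == a) || (size x == b)) && all [in G] x}.

Definition Gamma_adj : rel Gamma_vert := fun x y =>
  let s : seq gT := val x in
  let t : seq gT := val y in
  ((size s == a) && (size t == b) || (size s == b) && (size t == a))
  && (<<[set z in s ++ t]>> == G).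

Fact Gamma_adj_sym : symmetric Gamma_adj.
Proof.
move=> x y; rewrite /Gamma_adj orbC ![(size (val x) == _) && _]andbC.
congr (_ && _); congr (<<_>> == _).
by apply/setP=> z; rewrite !inE !mem_cat orbC.
Qed.

Definition Gamma : loop_graph := LoopGraph Gamma_adj_sym.

Definition Gamma_star : loop_graph := delete_isolated Gamma.

End Gamma.

(* One index for each member of the collection Lambda^*(G), so that isomorphic
   components occurring several times are counted with multiplicity. *)
Record Lambda_index := LambdaIndex {
  Lambda_a : nat;
  Lambda_b : nat;
  Lambda_leq : Lambda_a <= Lambda_b;
  Lambda_comp : {set vert (Gamma_star Lambda_a Lambda_b)};
  Lambda_compP : Lambda_comp \in components (Gamma_star Lambda_a Lambda_b) }.

Definition Lambda_graph (i : Lambda_index) : loop_graph :=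
  induced (Lambda_comp i).

(* Each K in the path from 1 is normal in G, hence normalised by L, so that
   L / K is the usual quotient. *)
Definition supersolvable : Prop :=
  exists2 s : seq {group gT},
    path [rel K L : {group gT} | [&& L <| G, K \subset L & cyclic (L / K)]]
         1%G s
    & last 1%G s = G.

Definition nb_maximal_of_index (n : nat) : nat :=
  #|[set M : {group gT} | maximal M G & #|G : M| == n]|.

End GeneratingGraphs.

Definition same_Lambda (gT hT : finGroupType) (G : {group gT})
    (H : {group hT}) : Prop :=
  exists2 f : Lambda_index G -> Lambda_index H,
    bijective f & forall i, graph_iso (Lambda_graph i) (Lambda_graph (f i)).

(* Main.v *)
Require Import Defs.
From mathcomp Require Import all_boot all_fingroup all_solvable.
From mathcomp Require Import all_algebra finfield mxrepresentation mxabelem.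

(** Let [b] be large. The graph [Gamma_star G 1 b] is connected and bipartite,
    with the elements of [G] on one side. An element [g] and a tuple [y] fail to
    be adjacent exactly when some maximal subgroup contains both, so the
    non-neighbours of [y] form the union of the maximal subgroups containing
    [y], and the minimal nonempty sets of this form are the maximal subgroups
    of [G] ([maximal_minset]). Hence this single graph, without its labels,
    determines the family of maximal subgroups as a family of subsets of the
    set [G].

    The isomorphic member of the other collection comes from some
    [Gamma_star H a' b']. By counting vertices, and as a connected bipartite
    graph has a unique bipartition, it is the whole of that graph, and the
    elements of [G] correspond to the words of length [a']. So the order of [G]
    is a power of the order of [H], and by symmetry the orders are equal and,
    unless both groups are trivial, [a'] is [1] ([same_Lambda_sided_iso1]).
    This gives a bijection [f] from [G] to [H] that matches the maximal
    subgroups ([same_Lambda_maximal_bijection]), hence their numbers for each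
    index.

    Solvability. Suppose that [G] is solvable. Two maximal subgroups [M], [L] of
    [G] with different cores satisfy [M * L = G], and two with the same core
    are conjugate ([same_core_maximal_conj], due to Ore). So conjugacy is
    visible in the cardinals of intersections: [M] and [L] are conjugate if and
    only if [#|M :&: L| * #|G|] differs from [#|M| * #|L|]. Through [f] this
    determines the conjugates in [H] of a maximal subgroup that is not normal,
    and so its core, the intersection of the conjugates
    ([maximal_bijection_gcore]). If [H] were not solvable, there would be a
    normal subgroup [R], an integer [n > 1] and, for each prime divisor [p] of
    [n], a maximal subgroup with core [R] and an index prime to [p] dividing
    [n] ([nonsolvable_core_maximals]). The corresponding maximal subgroups of
    [G] have the same core, so they are conjugate and all these indices are
    equal, to a divisor of [n] prime to [n]: a maximal subgroup would have
    index [1].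

    Supersolvability. By Huppert's theorem a solvable group is supersolvable if
    and only if all its maximal subgroups have prime index. For the harder half
    ([maximal_prime_index_minnormal]), let [N] be a minimal normal [p]-subgroup
    and [D] the subgroup generated by the commutators and the [(p - 1)]-th
    powers. A Frattini argument shows that a Hall [p']-subgroup of [D] is normal
    in [G]; therefore [D] centralises [N], so that [G] acts on [N] through an
    abelian group of exponent dividing [p - 1]. Over the field with [p]
    elements such an action is diagonalisable, and [N] has order [p]. *)

Set Implicit Arguments.
Unset Strict Implicit.
Unset Printing Implicit Defensive.

Local Open Scope group_scope.

(** * Images of subsets under a map injective on a set *)

Section ImagesOn.

Variables (aT rT : finType) (D : {set aT}) (f : aT -> rT).
Hypothesis injf : {in D &, injective f}.
Implicit Types S T : {set aT}.

Lemma card_imset_on S : S \subset D -> #|f @: S| = #|S|.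
Proof.
move=> sSD; apply: card_in_imset => x y Sx Sy.
by apply: injf; apply: (subsetP sSD).
Qed.

Lemma mem_imset_on S x :
  S \subset D -> x \in D -> (f x \in f @: S) = (x \in S).
Proof.
move=> sSD Dx; apply/imsetP/idP=> [[y Sy] | Sx]; last by exists x.
by move/injf=> -> //; apply: (subsetP sSD).
Qed.

Lemma card_imset_setI_on S T :
  S \subset D -> T \subset D -> #|f @: S :&: f @: T| = #|S :&: T|.
Proof.
move=> sSD sTD; rewrite -imsetI => [|x y Sx Ty].
  by rewrite card_imset_on // (subset_trans (subsetIl _ _)).
by apply: injf; [apply: (subsetP sSD) | apply: (subsetP sTD)].
Qed.

Lemma imset_inj_on S T :
  S \subset D -> T \subset D -> f @: S = f @: T -> S = T.
Proof.
move=> sSD sTD eqST; apply/setP=> x; case Dx: (x \in D); last first.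
  by rewrite !(contraFF (subsetP _ x) Dx).
by rewrite -(mem_imset_on sSD Dx) eqST mem_imset_on.
Qed.

Lemma imset_preimset_on (T : {set rT}) :
  T \subset f @: D -> f @: (D :&: f @^-1: T) = T.
Proof.
move=> sTD; apply/setP=> y; apply/imsetP/idP=> [[x] | Ty].
  by rewrite !inE => /andP[_ Tfx] ->.
have /imsetP[x Dx def_y] := subsetP sTD y Ty.
by exists x; rewrite // !inE Dx -def_y.
Qed.

End ImagesOn.


(** * Cores and conjugacy of maximal subgroups *)

Section MaximalSubgroups.

Variable gT : finGroupType.
Implicit Types G H K L M N V : {group gT}.

Lemma sub_maximal_eq M G H :
  maximal M G -> M \subset H -> H \subset G -> H :=: M \/ H :=: G.
Proof.
move=> maxM; have: maximal_eq M G by rewrite /maximal_eq maxM orbT.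
by case/maximal_eqP=> _; apply.
Qed.

Lemma maximal_sub M G : maximal M G -> M \subset G.
Proof. by case/maxgroupP=> /proper_sub. Qed.

Lemma mulg_maximal_normal M L G :
  maximal M G -> L <| G -> ~~ (L \subset M) -> M * L = G.
Proof.
move=> maxM /andP[sLG nLG] notLM; have sMG := maximal_sub maxM.
rewrite -norm_joinEl ?(subset_trans sMG) //.
have [|eqM|//] := sub_maximal_eq maxM (joing_subl M L).
  by rewrite join_subG sMG.
by case/negP: notLM; rewrite -eqM joing_subr.
Qed.

Lemma core_free_norm_trivg M V G (D : {group gT}) :
    M * V = G -> gcore M G = 1 -> D \subset M ->
    M \subset 'N(D) -> V \subset 'N(D) ->
  D :=: 1.
Proof.
move=> defG core1 sDM nDM nDV; apply/trivgP; rewrite -core1.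
by rewrite gcore_max // -defG mul_subG.
Qed.

(** As [V] is abelian and normal, [M :&: V] and ['C_M(V)] are normalised by both
    [M] and [V], hence by [G], so that both lie in the core of [M]. *)
Lemma core_free_complement M V G :
    maximal M G -> gcore M G = 1 -> minnormal V G -> V \subset G -> abelian V ->
  [/\ M * V = G, M :&: V = 1 & 'C_G(V) = V].
Proof.
move=> maxM core1 minV sVG abV.
have /andP[ntV nVG] := mingroupp minV; have sMG := maximal_sub maxM.
have notVM: ~~ (V \subset M).
  by apply: contra ntV => sVM; rewrite -subG1 -core1 gcore_max.
have defG: M * V = G.
  by apply: mulg_maximal_normal => //; rewrite /normal sVG.
have trivgN := core_free_norm_trivg defG core1.
split=> //.
  apply: (trivgN (M :&: V)%G); first exact: subsetIl.
    by rewrite normsI ?normG // (subset_trans sMG).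
  by rewrite cents_norm // centsC (subset_trans (subsetIr _ _) abV).
have tiCM: 'C_M(V) = 1.
  apply: (trivgN 'C_M(V)%G); first exact: subsetIl.
    by rewrite normsI ?normG // norms_cent // (subset_trans sMG).
  by rewrite cents_norm // centsC subsetIr.
have sVC: V \subset 'C_G(V) by rewrite subsetI sVG.
apply/eqP; rewrite eqEsubset sVC andbT.
have: 'C_G(V) \subset (V * M) :&: 'C_G(V).
  rewrite subsetI subxx andbT subIset // -defG normC ?subxx //.
  exact: subset_trans sMG nVG.
rewrite -group_modl // (_ : M :&: _ = 1) ?mulg1 //.
by rewrite setIA (setIidPl sMG).
Qed.

(** Let [V] be a minimal normal subgroup, a [p]-group, of the solvable group
    [G], and [L / V] a minimal normal subgroup of [G / V], an [r]-group. If
    [L] were a [p]-group, it would centralise [V], which is its own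
    centraliser; so [r] is not [p], and a core-free maximal subgroup, being a
    complement of [V], meets [L] in a Sylow [r]-subgroup of [L], whose
    normaliser it is. Sylow's theorem in [L] conjugates these
    intersections, hence their normalisers. *)
Lemma core_free_maximal_conj G M1 M2 :
    solvable G -> maximal M1 G -> maximal M2 G ->
    gcore M1 G = 1 -> gcore M2 G = 1 ->
  exists2 x, x \in G & M2 :=: M1 :^ x.
Proof.
move=> solG maxM1 maxM2 core1 core2.
have ntG: G :!=: 1.
  by have /andP[ltMG _] := maxgroupp maxM1; apply: contraTneq maxM1 => ->;
     apply/negP=> /maxgroupp; rewrite properE sub1G andbF.
have [V minV sVG] := minnormal_exists ntG (normG G).
have [nVG ntV abelV] := minnormal_solvable minV sVG solG.
case/is_abelemP: abelV => p p_pr abelV; have [pV abV _] := and3P abelV.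
have nsVG: V <| G by apply/andP.
have [defG1 ti1 cVV] := core_free_complement maxM1 core1 minV sVG abV.
have [defG2 ti2 _] := core_free_complement maxM2 core2 minV sVG abV.
have cardM M : M * V = G -> M :&: V = 1 -> #|M| = #|G : V|.
  move=> defG ti; apply/eqP; rewrite -(eqn_pmul2r (cardG_gt0 V)).
  by rewrite -TI_cardMg // defG mulnC Lagrange.
have [eqGV | ltVG] := eqVproper sVG.
  have cardM1 M : M * V = G -> M :&: V = 1 -> M :=: 1.
    by move=> defG ti; apply/eqP; rewrite trivg_card1 cardM // eqGV indexgg.
  by exists 1; rewrite ?group1 // conjsg1 (cardM1 _ defG1) // (cardM1 _ defG2).
have ntGV: G / V != 1 by rewrite -subG1 quotient_sub1 // proper_subn.
have [Lb minL sLGb] := minnormal_exists ntGV (normG (G / V)).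
have [nLb ntLb abelL] := minnormal_solvable minL sLGb (quotient_sol V solG).
have [L defL sVL sLG] := inv_quotientS nsVG sLGb.
have nsLG: L <| G.
  by rewrite -(quotientGK nsVG) -(quotientGK (normalS sVL sLG nsVG)) -defL;
     rewrite cosetpre_normal /normal sLGb.
case/is_abelemP: abelL => r r_pr /and3P[rL _ _]; rewrite defL in rL ntLb.
have [nVL nLG] := (subset_trans sLG nVG, normal_norm nsLG).
have neq_rp: r != p.
  apply: contra ntLb => /eqP eq_rp; rewrite {r}eq_rp in rL r_pr.
  have pL: p.-group L by rewrite -(pquotient_pgroup pV nVL).
  have ntVZ := meet_center_nil (pgroup_nil pL) (normalS sVL sLG nsVG) ntV.
  have [_ minV'] := mingroupP minV.
  have eqVZ: V :&: 'Z(L) = V.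
    apply: (minV' (V :&: 'Z(L))%G) (subsetIl _ _).
    by rewrite ntVZ normsI // gFnorm_trans.
  rewrite -subG1 quotient_sub1 // -cVV subsetI sLG.
  by rewrite centsC -eqVZ subIset // subsetIr orbT.
have sylM M : M * V = G -> M :&: V = 1 -> M \subset G -> r.-Sylow(L) (M :&: L).
  move=> defG ti sMG.
  have defL' : (M :&: L) * V = L.
    by rewrite setIC group_modr // defG (setIidPl sLG).
  have tiML : M :&: L :&: V = 1 by rewrite setIAC ti setI1g.
  have cML: #|M :&: L| = #|L / V|.
    rewrite card_quotient //; apply/eqP; rewrite -(eqn_pmul2r (cardG_gt0 V)).
    by rewrite -TI_cardMg // defL' mulnC Lagrange.
  rewrite /pHall subsetIr /pgroup cML [_.-nat _]rL /=.
  rewrite -divgS ?subsetIr //= -{1}defL' TI_cardMg // mulKn //.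
  by apply: sub_in_pnat pV => q _ /eqnP->; rewrite !inE eq_sym.
have normM M : maximal M G -> gcore M G = 1 -> M * V = G -> M :&: V = 1 -> 
   'N_G(M :&: L) = M.
  move=> maxM coreM defG ti; have sMG := maximal_sub maxM.
  have sMN: M \subset 'N_G(M :&: L).
    by rewrite subsetI sMG normsI ?normG // (subset_trans sMG).
  have [//|eqN] := sub_maximal_eq maxM sMN (subsetIl _ _).
  have eq1: M :&: L = 1.
    apply/trivgP; rewrite -coreM gcore_max ?subsetIl //.
    by rewrite -{1}eqN subsetIr.
  case/negP: ntLb; rewrite -subG1 quotient_sub1 //.
  by rewrite -{1}(setIidPl sLG) -defG -group_modr // setIC eq1 mul1g.
have sM1G := maximal_sub maxM1; have sM2G := maximal_sub maxM2.
have [x Lx eqS] := Sylow_trans (sylM _ defG1 ti1 sM1G) (sylM _ defG2 ti2 sM2G).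
exists x; first exact: subsetP Lx.
have Gx: x \in G by apply: subsetP Lx.
by rewrite -(normM _ maxM2) // eqS normJ -{1}(conjGid Gx) -conjIg normM.
Qed.

End MaximalSubgroups.

Section ConjugateMaximals.

Variable gT : finGroupType.
Implicit Types G H K L M N P Q R V : {group gT}.

Lemma gcore_quotient_core K M G :
  M \subset G -> K :=: gcore M G -> gcore (M / K) (G / K) = 1.
Proof.
move=> sMG defK; have nsKG: K <| G by rewrite defK gcore_normal.
have sKM: K \subset M by rewrite defK gcore_sub.
have sDM: coset K @*^-1 gcore (M / K) (G / K) \subset M.
  by rewrite sub_cosetpre_quo ?gcore_sub ?(normalS sKM sMG).
apply/trivgP; rewrite -cosetpreSK -[_ @*^-1 1]/('ker _) ker_coset.
rewrite [X in _ \subset (X : {set _})]defK gcore_max // -{1}(quotientGK nsKG).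
by rewrite (subset_trans _ (morphpre_norm _ _)) // cosetpreSK gcore_norm.
Qed.

Lemma same_core_maximal_conj G M1 M2 :
    solvable G -> maximal M1 G -> maximal M2 G -> gcore M1 G = gcore M2 G ->
  exists2 x, x \in G & M2 :=: M1 :^ x.
Proof.
move=> solG maxM1 maxM2 eq_core.
have sM1G := maximal_sub maxM1; have sM2G := maximal_sub maxM2.
pose K := [group of gcore M1 G].
have core1 := gcore_quotient_core sM1G (erefl (gval K)).
have core2 := gcore_quotient_core sM2G (eq_core : K :=: gcore M2 G).
have sK1: K \subset M1 := gcore_sub M1 G.
have sK2: K \subset M2 by rewrite /= eq_core gcore_sub.
have nsKG: K <| G := gcore_normal sM1G.
have nsKM1 := normalS sK1 sM1G nsKG; have nsKM2 := normalS sK2 sM2G nsKG.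
have [|||||y] := @core_free_maximal_conj _ (G / K)%G (M1 / K)%G (M2 / K)%G.
- exact: quotient_sol.
- by rewrite quotient_maximal.
- by rewrite quotient_maximal.
- exact: core1.
- exact: core2.
case/morphimP=> x nKx Gx ->{y} /= eqM; exists x => //.
rewrite -(quotientGK nsKM2) eqM -quotientJ // quotientGK //.
by rewrite -{1}(normP nKx) normalJ.
Qed.

(** One of the two maximal subgroups does not contain the core of the other,
    a normal subgroup, and so supplements it. *)
Lemma diff_core_maximal_mul G M1 M2 :
    maximal M1 G -> maximal M2 G -> gcore M1 G != gcore M2 G -> M1 * M2 = G.
Proof.
have aux (A B : {group gT}) : maximal A G -> maximal B G ->
    ~~ (gcore B G \subset A) -> A * B = G.
- move=> maxA maxB notBA.
  have [sAG sBG] := (maximal_sub maxA, maximal_sub maxB).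
  apply/eqP; rewrite eqEsubset mul_subG //=.
  rewrite -(mulg_maximal_normal maxA (gcore_normal sBG) notBA).
  by rewrite mulgS // gcore_sub.
move=> max1 max2; rewrite eqEsubset negb_and.
case/orP; rewrite sub_gcore ?gcore_norm // => not12; last exact: aux.
by rewrite -[RHS]invGid -(aux _ _ max2 max1 not12) invMg !invGid.
Qed.

(** When [S] is a subgroup, the condition on [T] says that [S * T] is not the
    whole of [G]; it is put in terms of cardinals in order to be preserved by
    bijections that are not homomorphisms. *)
Definition clash G (S : {set gT}) :=
  [set T : {set gT} | maximal T G & (#|S :&: T| * #|G| != #|S| * #|T|)%N].

Lemma mulg_cardE G M N : M \subset G -> N \subset G ->
  (M * N == G) = (#|M :&: N| * #|G| == #|M| * #|N|)%N.
Proof.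
move=> sMG sNG; rewrite eqEcard mul_subG // mul_cardG mulnC.
rewrite eqn_pmul2r ?cardG_gt0 // eqn_leq andbC.
by rewrite (subset_leq_card (mul_subG sMG sNG)).
Qed.

(** If [M * M :^ x] were [G], then [x] would be a product of elements of [M],
    and [M :^ x] would be [M]. *)
Lemma conj_sub_clash G M : maximal M G -> M :^: G \subset clash G M.
Proof.
move=> maxM; have sMG := maximal_sub maxM; have ltMG := maxgroupp maxM.
apply/subsetP=> _ /imsetP[x Gx ->]; rewrite inE -{1}(conjGid Gx) maximalJ maxM.
rewrite -(@mulg_cardE G M (M :^ x)%G) //; last by rewrite -(conjGid Gx) conjSg.
apply/eqP=> defG; have: x \in M * M :^ x by rewrite defG.
case/mulsgP=> m _ Mm /imsetP[m' Mm' ->]; rewrite conjgE => eqx.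
have Mx: x \in M.
  suff -> : x = m' * m by rewrite groupM.
  have eq1: m * x^-1 * m' = 1.
    by apply: (mulIg x); rewrite mul1g [RHS]eqx !mulgA.
  rewrite -[x]invgK -[x^-1](mulKg m) -[m * x^-1](mulgK m') eq1 mul1g.
  by rewrite invMg !invgK.
have eqMM: M :^ x = M by rewrite conjGid.
by move: defG ltMG; rewrite /= eqMM mulGid => ->; rewrite properxx.
Qed.

Lemma maximal_group_set G (T : {set gT}) : maximal T G -> group_set T.
Proof. by case/maxsetP=> /andP[]. Qed.

Lemma clash_solvable G M : solvable G -> maximal M G -> clash G M = M :^: G.
Proof.
move=> solG maxM; apply/eqP; rewrite eqEsubset conj_sub_clash // andbT.
apply/subsetP=> T; rewrite inE => /andP[maxT neqMT].
pose T' := Group (maximal_group_set maxT).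
have [eq_core | neq_core] := eqVneq (gcore M G) (gcore T G).
  have [x Gx defT] := @same_core_maximal_conj G M T' solG maxM maxT eq_core.
  by apply/imsetP; exists x.
case/negP: neqMT; rewrite -(@mulg_cardE G M T') ?maximal_sub //.
by rewrite (@diff_core_maximal_mul G M T').
Qed.

(** A maximal subgroup that is not normal is self-normalising. *)
Lemma card_maximal_conjugates G M :
  maximal M G -> ~~ (M <| G) -> #|M :^: G| = #|G : M|.
Proof.
move=> maxM notnM; have sMG := maximal_sub maxM.
have sMN: M \subset 'N_G(M) by rewrite subsetI sMG normG.
rewrite card_conjugates.
have [-> //|eqN] := sub_maximal_eq maxM sMN (subsetIl _ _).
by case/negP: notnM; rewrite /normal sMG -{1}eqN subsetIr.
Qed.

Lemma card_maximal_conjugates_le G M : maximal M G -> #|M :^: G| <= #|G : M|.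
Proof.
move=> maxM; rewrite card_conjugates dvdn_leq // indexgS //.
by rewrite subsetI maximal_sub // normG.
Qed.

(** Both sides are the quotient of [#|N|] by [#|M :&: N|]. *)
Lemma index_mulg_eq G M N :
  N \subset G -> M * N = G -> #|G : M| = #|N : M :&: N|.
Proof.
move=> sNG defG; have sMG: M \subset G by rewrite -defG mulG_subl.
apply/eqP; rewrite -(eqn_pmul2l (cardG_gt0 (M :&: N))) Lagrange ?subsetIr //.
rewrite -(eqn_pmul2l (cardG_gt0 M)) mulnCA Lagrange // (mul_cardG M) defG.
by rewrite mulnC.
Qed.

(** A minimal normal subgroup [N] of [Q] is not solvable and lies in every
    nontrivial normal subgroup; the number [n] is its order. A Sylow
    [p]-subgroup [P] of [N] is not normal in [Q], and a maximal subgroup [M]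
    containing its normaliser does not contain [N], by the Frattini argument.
    So [M] is core-free and its index is that of [M :&: N] in [N], which
    is prime to [p] because [M :&: N] contains [P]. *)
Lemma minimal_nonsolvable_maximals Q :
    ~~ solvable Q ->
    (forall L, L <| Q -> L :!=: 1 -> solvable (Q / L)) ->
  exists2 n, 1 < n & forall p, prime p -> p %| n -> exists M,
    [/\ maximal M Q, gcore M Q = 1, ~~ (M <| Q),
        ~~ (p %| #|Q : M|) & #|Q : M| %| n].
Proof.
move=> nsolQ solquo.
have ntQ: Q :!=: 1 by apply: contraNneq nsolQ => ->; apply: solvable1.
have [N minN sNQ] := minnormal_exists ntQ (normG Q).
have /andP[ntN nNQ] := mingroupp minN; have nsNQ: N <| Q by apply/andP.
have nsolN: ~~ solvable N.
  by apply: contra nsolQ => solN; rewrite (series_sol nsNQ) solN solquo.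
have sN L : L <| Q -> L :!=: 1 -> N \subset L.
  move=> nsLQ ntL; have [ti | nti] := eqVneq (N :&: L) 1.
    case/negP: nsolN; have nLN := subset_trans sNQ (normal_norm nsLQ).
    rewrite (isog_sol (quotient_isog nLN _)) 1?setIC //.
    exact: solvableS (quotientS L sNQ) (solquo L nsLQ ntL).
  have [_ minN'] := mingroupP minN.
  have <-: N :&: L = N.
    apply: (minN' (N :&: L)%G); last exact: subsetIl.
    by rewrite nti normsI // normal_norm.
  exact: subsetIr.
exists #|N|; [by rewrite cardG_gt1 | move=> p p_pr p_dv].
have [P sylP] := Sylow_exists p N.
have [sPN pP p'NP] := and3P sylP.
have ntP: P :!=: 1.
  by rewrite -cardG_gt1 (card_Hall sylP) p_part_gt1 mem_primes p_pr cardG_gt0.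
have defQ := Frattini_arg nsNQ sylP.
have sNP_Q: 'N_Q(P) \subset Q := subsetIl _ _.
have [eqQ | [M maxM sNPM]] := maximal_exists sNP_Q.
  have nsPQ: P <| Q by rewrite /normal (subset_trans sPN sNQ) -{1}eqQ subsetIr.
  by case/negP: nsolQ; rewrite (series_sol nsPQ) (pgroup_sol pP) solquo.
have sPM: P \subset M.
  by rewrite (subset_trans _ sNPM) // subsetI (subset_trans sPN) // normG.
have defMN: M * N = Q.
  have notNM: ~~ (N \subset M).
    apply/negP=> sNM; have := maxgroupp maxM; rewrite -defQ.
    by rewrite properE mul_subG ?andbF.
  exact: mulg_maximal_normal.
have notNM L : L <| Q -> L \subset M -> L :=: 1.
  move=> nsLQ sLM; apply/eqP; apply: contraT => ntL; have := maxgroupp maxM.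
  by rewrite -defMN properE mul_subG ?andbF // (subset_trans (sN L _ _)).
exists M; split=> //.
- apply: (notNM [group of gcore M Q]); last exact: gcore_sub.
  exact: gcore_normal (maximal_sub maxM).
- by apply: contra ntP => nsMQ; rewrite -subG1 -(notNM M).
- rewrite (index_mulg_eq sNQ defMN) -p'natE //.
  apply: pnat_dvd p'NP.
  by rewrite indexgS // subsetI sPM.
by rewrite (index_mulg_eq sNQ defMN) dvdn_indexg.
Qed.

End ConjugateMaximals.

Section CoreMaximals.

Variable gT : finGroupType.
Implicit Types G H K L M N P Q R V : {group gT}.

(** The previous lemma, applied to the quotient of [H] by a normal subgroup [R]
    that is maximal among those with a non-solvable quotient. *)
Lemma nonsolvable_core_maximals H :
    ~~ solvable H ->
  exists R, exists2 n, 1 < n & forall p, prime p -> p %| n -> exists M,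
    [/\ maximal M H, gcore M H = R, ~~ (M <| H),
        ~~ (p %| #|H : M|) & #|H : M| %| n].
Proof.
move=> nsolH; pose good R := (R <| H) && ~~ solvable (H / R).
have [|R /maxgroupP[/andP[nsRH nsolHR] maxR]] := @ex_maxgroup _ good.
  by exists 1%G; rewrite /good normal1 -(isog_sol (quotient1_isog H)).
have [|n n_gt1 maxn] := @minimal_nonsolvable_maximals _ (H / R)%G nsolHR.
  move=> Lb /(inv_quotientN nsRH)[L defLb sRL nsLH] ntLb.
  rewrite defLb (isog_sol (third_isog sRL nsRH nsLH)).
  apply: contraNT ntLb => nsolHL; rewrite defLb.
  by rewrite (maxR L) ?trivg_quotient // /good nsLH.
exists R, n => // p p_pr /(maxn p p_pr)[Mb [maxM coreM nsM p'M dvM]].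
have sMH := maximal_sub maxM.
have [M defM sRM sMH'] := inv_quotientS nsRH sMH.
have nsRM := normalS sRM sMH' nsRH.
have idx: #|H / R : Mb| = #|H : M|.
  by rewrite defM index_quotient_eq // ?normal_norm // subIset ?sRM ?orbT.
exists M; split; rewrite -?idx //.
- by rewrite -(quotient_maximal nsRM nsRH) -defM.
- apply/eqP; rewrite eqEsubset gcore_max ?normal_norm // andbT.
  rewrite -quotient_sub1; last first.
    by rewrite (subset_trans _ (normal_norm nsRH)) //
               (subset_trans (gcore_sub _ _)).
  rewrite -coreM gcore_max ?quotient_norms ?gcore_norm //.
  by rewrite defM quotientS ?gcore_sub.
by apply: contra nsM => nsMH; rewrite defM quotient_normal.
Qed.

End CoreMaximals.

(** * Bijections preserving maximal subgroups *)

Lemma set_maximal_sub (kT : finGroupType) (K : {group kT}) (S : {set kT}) :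
  maximal S K -> S \subset K.
Proof.
by move=> maxS; apply: (@maximal_sub _ (Group (maximal_group_set maxS))).
Qed.

(** All that the proof retains from the graphs. Nothing relates [f] to the
    group laws, so that [S] ranges over arbitrary subsets. *)
Definition maximal_bijection (gT hT : finGroupType) (G : {group gT})
    (H : {group hT}) (f : gT -> hT) :=
  [/\ {in G &, injective f}, f @: G = H
    & forall S : {set gT}, S \subset G -> maximal (f @: S) H = maximal S G].

Section MaximalBijection.

Variables (gT hT : finGroupType) (G : {group gT}) (H : {group hT}).
Variable f : gT -> hT.
Hypothesis fP : maximal_bijection G H f.

Let injf : {in G &, injective f}. Proof. by case: fP. Qed.
Let imf : f @: G = H. Proof. by case: fP. Qed.
Let maxf (S : {set gT}) : S \subset G -> maximal (f @: S) H = maximal S G.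
Proof. by case: fP => _ _; apply. Qed.

Lemma maximal_bijection_card : #|G| = #|H|.
Proof. by rewrite -imf card_in_imset. Qed.

Let imset_preimset_f (T : {set hT}) :
  T \subset H -> f @: (G :&: f @^-1: T) = T.
Proof. by rewrite -{1}imf; apply: imset_preimset_on. Qed.

Lemma maximal_bijection_lift (M : {group hT}) : maximal M H ->
  exists2 L : {group gT}, maximal L G & f @: L = M.
Proof.
move=> maxM; have defM := imset_preimset_f (maximal_sub maxM).
have maxL: maximal (G :&: f @^-1: M) G by rewrite -maxf ?subsetIl ?defM.
by exists (Group (maximal_group_set maxL)).
Qed.

Lemma clash_imset (S : {set gT}) : S \subset G ->
  clash H (f @: S) = [set f @: (T : {set gT}) | T in clash G S].
Proof.
move=> sSG; apply/setP=> T'; apply/idP/imsetP=> [|[T]].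
  rewrite inE => /andP[maxT' neq].
  have defT' := imset_preimset_f (set_maximal_sub maxT').
  exists (G :&: f @^-1: T'); last by rewrite defT'.
  rewrite inE -maxf ?subsetIl // defT' maxT' /=.
  move: neq; rewrite -{1 2}defT' (card_imset_setI_on injf) ?subsetIl //.
  by rewrite !(card_imset_on injf) ?subsetIl // maximal_bijection_card.
rewrite inE => /andP[maxT neq] ->; have sTG := set_maximal_sub maxT.
rewrite inE maxf // maxT (card_imset_setI_on injf) // !(card_imset_on injf) //.
by rewrite -maximal_bijection_card.
Qed.

Lemma card_clash_imset (S : {set gT}) :
  S \subset G -> #|clash H (f @: S)| = #|clash G S|.
Proof.
move=> sSG; rewrite clash_imset // card_in_imset // => T1 T2.
rewrite !inE => /andP[/set_maximal_sub sT1 _] /andP[/set_maximal_sub sT2 _].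
exact: (imset_inj_on injf).
Qed.

Lemma mem_gcore (kT : finGroupType) (K L : {group kT}) x :
  (x \in gcore L K) = [forall T in L :^: K, x \in (T : {set kT})].
Proof.
apply/bigcapP/forall_inP=> [Lx _ /imsetP[y Ky ->] | Lx y Ky]; first exact: Lx.
by apply: Lx; apply: imset_f.
Qed.

(** When [G] is solvable, the maximal subgroups clashing with [L] are its
    conjugates, at most [#|G : L|] in number. The conjugates of the image [M]
    of [L] clash with [M], and there are [#|H : M|] of them, so they account
    for the whole clash of [M]: intersecting the clashes matches the cores. *)
Lemma maximal_bijection_gcore (L : {group gT}) (M : {group hT}) :
    solvable G -> maximal L G -> f @: L = M -> ~~ (M <| H) ->
  gcore L G = G :&: f @^-1: gcore M H.
Proof.
move=> solG maxL defM notnM; have sLG := maximal_sub maxL.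
have maxM: maximal M H by rewrite -defM maxf.
have idxLM: #|G : L| = #|H : M|.
  rewrite -!divgS //; last exact: maximal_sub.
  by rewrite maximal_bijection_card -defM (card_imset_on injf).
have clM: clash H M = M :^: H.
  apply/esym/eqP; rewrite eqEcard conj_sub_clash //= card_maximal_conjugates //.
  rewrite -idxLM -defM card_clash_imset // clash_solvable //.
  exact: card_maximal_conjugates_le.
apply/setP=> x; rewrite !inE; case Gx: (x \in G) => /=; last first.
  by apply: contraFF Gx; apply/subsetP; rewrite (subset_trans (gcore_sub _ _)).
rewrite !mem_gcore -clM -clash_solvable // -defM clash_imset //.
apply/forall_inP/forall_inP=> [xL _ /imsetP[T clT ->] | xM T clT].
  by rewrite imset_f // xL.
have:= xM _ (imset_f _ clT); rewrite (mem_imset_on injf) //.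
by move: clT; rewrite inE => /andP[/set_maximal_sub].
Qed.

(** The maximal subgroups [M_p] of [H] provided by [nonsolvable_core_maximals]
    have the same core [R], hence so have their counterparts in [G], which are
    conjugate if [G] is solvable. So the [M_p] have the same index, prime to
    each of its own prime divisors. *)
Theorem maximal_bijection_solvable : solvable G -> solvable H.
Proof.
move=> solG; apply: contraT => /nonsolvable_core_maximals[R [n n_gt1 maxn]].
have maxL p : prime p -> p %| n -> exists M : {group hT}, exists L : {group gT},
    [/\ ~~ (p %| #|H : M|), #|H : M| %| n, maximal L G, #|G : L| = #|H : M|
      & gcore L G = G :&: f @^-1: R].
  move=> p_pr p_n; have [M [maxM coreM nsM p'M dvM]] := maxn p p_pr p_n.
  have [L maxL defM] := maximal_bijection_lift maxM.
  have [sLG sMH] := (maximal_sub maxL, maximal_sub maxM).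
  exists M, L; split=> //; last first.
    by rewrite -coreM; apply: maximal_bijection_gcore.
  by rewrite -!divgS // maximal_bijection_card -defM (card_imset_on injf).
have [M [L [_ dvM maxL1 idxL coreL]]] := maxL _ (pdiv_prime n_gt1) (pdiv_dvd n).
have idx_gt1: 1 < #|H : M|.
  by rewrite -idxL indexg_gt1 proper_subn //; case/maxgroupP: maxL1.
have q_pr := pdiv_prime idx_gt1; have q_dv := pdiv_dvd #|H : M|.
have [M2 [L2 [q'M2 _ maxL2 idxL2 coreL2]]] := maxL _ q_pr (dvdn_trans q_dv dvM).
case/negP: q'M2; rewrite -idxL2.
have eq_core := etrans coreL (esym coreL2).
have [x Gx ->] := same_core_maximal_conj solG maxL1 maxL2 eq_core.
by rewrite -{1}(conjGid Gx) indexJg idxL.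
Qed.

Lemma nb_maximal_of_indexE (kT : finGroupType) (K : {group kT}) n :
  nb_maximal_of_index K n = #|[set S | maximal S K & (#|S| * n == #|K|)%N]|.
Proof.
rewrite /nb_maximal_of_index -(card_imset _ (@group_inj kT)).
apply: eq_card => S.
apply/imsetP/idP=> [[M] | ]; rewrite !inE => /andP[maxM].
  move=> /eqP <- ->; rewrite maxM Lagrange ?eqxx //; exact: maximal_sub.
have sSK := set_maximal_sub maxM.
pose M := Group (maximal_group_set maxM); exists M => //; rewrite inE maxM /=.
by rewrite -(eqn_pmul2l (cardG_gt0 M)) Lagrange // eq_sym.
Qed.

Lemma maximal_bijection_nb_maximal n :
  nb_maximal_of_index G n = nb_maximal_of_index H n.
Proof.
rewrite !nb_maximal_of_indexE -maximal_bijection_card.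
rewrite -(card_in_imset (f := fun S : {set gT} => f @: S)); last first.
  move=> T1 T2; rewrite !inE => /andP[/set_maximal_sub sT1 _].
  by case/andP=> /set_maximal_sub sT2 _; apply: (imset_inj_on injf).
apply: eq_card => T; rewrite inE; apply/imsetP/andP=> [[S] | [maxT cardT]].
  rewrite inE => /andP[maxS cardS] ->; have sSG := set_maximal_sub maxS.
  by rewrite maxf // (card_imset_on injf).
have defT := imset_preimset_f (set_maximal_sub maxT).
exists (G :&: f @^-1: T); last by rewrite defT.
rewrite inE -maxf ?subsetIl // -(card_imset_on injf (subsetIl G _)).
by rewrite defT maxT.
Qed.

End MaximalBijection.

(** * Supersolvable groups and indices of maximal subgroups *)

Section Eigenvectors.

Import GRing.Theory.
Local Open Scope ring_scope.

(** The minimal polynomial of [A] divides [X^p - X], a product of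
    linear factors over the prime field. *)
Lemma Fp_eigenvalue_exists p n (A : 'M['F_p]_n.+1) :
  prime p -> A ^+ p = A -> exists a, eigenvalue A a.
Proof.
move=> p_pr Ap; have [/existsP // | /existsPn noroot] :=
  boolP [exists a, eigenvalue A a].
have dvA: mxminpoly A %| \prod_(a : 'F_p) ('X - a%:P).
  rewrite -finField_genPoly card_Fp // dvd_mxminpoly rmorphB rmorphXn /=.
  by rewrite !horner_mx_X Ap subrr.
have: coprimep (mxminpoly A) (\prod_(a : 'F_p) ('X - a%:P)).
  apply: (big_ind (coprimep (mxminpoly A))) => [|f g cof cog|a _].
  - exact: coprimep1.
  - by rewrite coprimepMr cof.
  by rewrite coprimep_XsubC -eigenvalue_root_min.
move/(coprimep_dvdl dvA); rewrite coprimepp size_mxminpoly eqSS.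
by rewrite (gtn_eqF (mxminpoly_nonconstant A)).
Qed.

End Eigenvectors.

Section Supersolvable.

Variable gT : finGroupType.
Implicit Types G H K L M N P Q R V : {group gT}.

Lemma abelem_eigenvector p N x :
    p.-abelem N -> prime p -> N :!=: 1 -> x \in 'N(N) -> x ^+ p.-1 \in 'C(N) ->
  exists2 u, u \in N^# & exists k, u ^ x = u ^+ k.
Proof.
move=> abelN p_pr ntN nNx cNx.
have nNX: <[x]> \subset 'N(N) by rewrite cycle_subG.
pose rX := abelem_repr abelN ntN nNX; have Xx := cycle_id x.
have xp: x ^+ p = x * x ^+ p.-1 by rewrite -expgS prednK ?prime_gt0.
have [|a /eigenvalueP[v defv nzv]] := @Fp_eigenvalue_exists p _ (rX x) p_pr.
  rewrite -repr_mxX // xp repr_mxM ?groupX //.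
  have: x ^+ p.-1 \in rker rX by rewrite rker_abelem inE groupX.
  by case/rkerP=> _ ->; rewrite mulmx1.
exists (rVabelem abelN ntN v).
  rewrite !inE mem_rVabelem andbT; apply: contra nzv => /eqP v1.
  by apply/eqP/(can_inj (rVabelemK abelN ntN)); rewrite v1 rVabelem0.
by exists a; rewrite -(rVabelemJ abelN ntN nNX) // defv rVabelemZ.
Qed.

(** Every element [x] of [G] has an eigenvector in [N], and the corresponding
    eigenspace is normalised by [G] because [G] acts on [N] as an abelian
    group: so it is [N], i.e. [G] acts on [N] by power maps. *)
Lemma minnormal_abelian_action_prime p N G :
    prime p -> p.-group N -> minnormal N G ->  G^`(1) \subset 'C(N) ->
    {in G, forall x, x ^+ p.-1 \in 'C(N)} ->
  #|N| = p.
Proof.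
move=> p_pr pN minN cG'N cNX.
have /andP[ntN nNG] := mingroupp minN; have [_ minN'] := mingroupP minN.
have abelN: p.-abelem N.
  have: is_abelem N.
    exact: charsimple_solvable (minnormal_charsimple minN) (pgroup_sol pN).
  case/is_abelemP=> q q_pr abelN.
  suff /eqP-> : p == q by [].
  have [_ p_dv _] := pgroup_pdiv pN ntN.
  exact: (pgroupP (abelem_pgroup abelN)).
have abN := abelem_abelian abelN.
have actN: {in G, forall x, exists k, {in N, forall u, u ^ x = u ^+ k}}.
  move=> x Gx; have nNx := subsetP nNG x Gx.
  have [u /setD1P[ntu Nu] [k def_ux]] :=
    abelem_eigenvector abelN p_pr ntN nNx (cNX x Gx).
  pose E := [set v in N | v ^ x == v ^+ k].
  have gE: group_set E.
    apply/group_setP; split=> [|v w].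
      by rewrite inE group1 conj1g expg1n eqxx.
    rewrite !inE => /andP[Nv /eqP vx] /andP[Nw /eqP wx].
    have cvw: commute v w by apply: (centsP abN).
    by rewrite groupM // conjMg vx wx expgMn /=.
  exists k; suff <-: E = N by move=> v; rewrite inE => /andP[_ /eqP].
  apply: (minN' (Group gE)); last by apply/subsetP=> v; rewrite inE => /andP[].
  apply/andP; split.
    by apply/trivgPn; exists u; rewrite // inE Nu def_ux eqxx.
  apply/subsetP=> y Gy; rewrite inE; apply/subsetP=> _ /imsetP[v Ev ->].
  move: Ev; rewrite !inE => /andP[Nv /eqP vx].
  rewrite memJ_norm ?(subsetP nNG) // Nv /=.
  have cxy: [~ x, y] \in 'C(N) by rewrite (subsetP cG'N) // mem_commg.
  rewrite -conjXg -vx -!conjgM [x * y]commgC (conjgM v (y * x)).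
  have Nvyx: v ^ (y * x) \in N by rewrite memJ_norm ?groupM ?(subsetP nNG).
  by rewrite (conjgE _ [~ x, y]) -(centP cxy _ Nvyx) mulKg.
have [u Nu ntu] := trivgPn _ ntN.
have eqN: <[u]> = N.
  apply: (minN' <[u]>%G); last by rewrite cycle_subG.
  rewrite cycle_eq1 ntu; apply/subsetP=> x Gx; rewrite inE.
  have [k actx] := actN x Gx.
  by rewrite -cycleJ cycle_subG actx ?mem_cycle.
by rewrite -eqN; apply: (abelem_order_p abelN).
Qed.

Lemma prime_order_action (rT : finGroupType) p (V G : {group rT}) x :
    prime p -> #|V| = p -> G \subset 'N(V) -> x \in G ->
  G^`(1) \subset 'C(V) /\ x ^+ p.-1 \in 'C(V).
Proof.
move=> p_pr oV nVG Gx; have cycV: cyclic V by rewrite prime_cyclic ?oV.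
have nVx := subsetP nVG x Gx.
have sAG := Aut_conj_aut V; have abA := Aut_cyclic_abelian cycV.
split.
  have sG'N: G^`(1) \subset 'N(V) by rewrite (subset_trans (der_sub 1 G)).
  rewrite -ker_conj_aut ker_trivg_morphim sG'N morphim_der //.
  by rewrite (derG1P (abelianS (sAG G) abA)) /=.
rewrite -ker_conj_aut; apply/kerP; rewrite ?groupX // morphX //.
have Ax: conj_aut V x \in Aut V by rewrite (subsetP (sAG G)) ?mem_morphim.
have := expg_cardG Ax; by rewrite card_Aut_cyclic // oV totient_prime.
Qed.

(** Modulo the core of [M], take for [V] a minimal normal subgroup: it is a
    complement of [M], hence of prime order, and its own centraliser, so that
    the quotient of [G] by [V] embeds in the automorphism group of a group of
    prime order. *)
Lemma maximal_prime_index_socle M G :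
    solvable G -> maximal M G -> prime #|G : M| ->
  exists V, [/\ V <| G, M :&: V \subset gcore M G, G^`(1) \subset V &
    {in G, forall x, x ^+ #|G : M|.-1 \in V}].
Proof.
move=> solG maxM p_pr; set p := #|G : M|; have sMG := maximal_sub maxM.
pose K := [group of gcore M G].
have nsKG: K <| G := gcore_normal sMG; have sKM: K \subset M := gcore_sub M G.
have nsKM := normalS sKM sMG nsKG.
have core1: gcore (M / K) (G / K) = 1.
  exact: gcore_quotient_core sMG (erefl (gval K)).
have maxMK: maximal (M / K) (G / K) by rewrite quotient_maximal.
have ntGK: G / K != 1.
  rewrite -subG1 quotient_sub1 ?normal_norm //; apply: contraL (maxgroupp maxM).
  by move=> sGK; rewrite properE (subset_trans sGK sKM) andbF.
have [Vb minV sVG] := minnormal_exists ntGK (normG (G / K)).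
have [nVG ntV abelV] := minnormal_solvable minV sVG (quotient_sol K solG).
have abV: abelian Vb by case/is_abelemP: abelV => q _ /abelem_abelian.
have [defG tiMV cVV] :=
  @core_free_complement _ (M / K)%G Vb (G / K)%G maxMK core1 minV sVG abV.
have oV: #|Vb| = p.
  have sGK_M: G :&: K \subset M := subset_trans (subsetIr _ _) sKM.
  rewrite -[p](index_quotient_eq sGK_M sMG (normal_norm nsKG)).
  by rewrite (index_mulg_eq sVG defG) tiMV indexg1.
have nsVbG: Vb <| G / K by apply/andP.
have [V defV sKV nsVG] := inv_quotientN nsKG nsVbG.
have preV: coset K @*^-1 Vb = V.
  by rewrite defV quotientGK // (normalS sKV (normal_sub nsVG)).
have nKG := normal_norm nsKG.
exists V; split=> // [||x Gx].
- rewrite -quotient_sub1 ?subIset ?(subset_trans sMG) //.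
  by rewrite -tiMV subsetI quotientS ?subsetIl //= defV quotientS ?subsetIr.
- rewrite -preV -sub_quotient_pre ?(subset_trans (der_sub 1 G)) //.
  rewrite quotient_der // -cVV subsetI der_sub /=.
  by have [] := prime_order_action p_pr oV nVG (group1 _).
have Nx := subsetP nKG x Gx; rewrite -preV; apply/morphpreP; split.
  exact: groupX.
rewrite morphX //= -cVV inE groupX ?mem_quotient //=.
by have [_] := prime_order_action p_pr oV nVG (mem_quotient K Gx).
Qed.

(** For a prime [p], the intersection of the kernels of the homomorphisms from
    [G] to the multiplicative group of the field with [p] elements. *)
Definition der_power G p := <<G^`(1) :|: [set x ^+ p.-1 | x in G]>>.

Canonical der_power_group G p := [group of der_power G p].

Lemma der_power_sub G p : der_power G p \subset G.
Proof.
rewrite gen_subG subUset der_sub /=.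
by apply/subsetP=> _ /imsetP[x Gx ->]; apply: groupX.
Qed.

Lemma der_power_normal G p : der_power G p <| G.
Proof.
apply: sub_der1_normal (der_power_sub G p).
exact: subset_trans (subsetUl _ _) (subset_gen _).
Qed.

Lemma mem_der_power G p x : x \in G -> x ^+ p.-1 \in der_power G p.
Proof. by move=> Gx; apply/mem_gen/setUP; right; apply/imsetP; exists x. Qed.

(** Write [D] for [der_power G p]. If [X] is not normal, a maximal subgroup [M]
    contains its normaliser. By the Frattini argument [M * D] is [G], so the
    index of [M] divides that of [X] in [D]: it is [p]. Then [D] lies in the
    subgroup [V] of [maximal_prime_index_socle], and [X], which lies in [M] and
    in [V], lies in the core of [M]. The Frattini argument for [X] in
    [D :&: gcore M G] now gives [G] as a product of two subgroups of [M]. *)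
Lemma Hall_der_power_normal G p (X : {group gT}) :
    solvable G -> prime p -> (forall M, maximal M G -> prime #|G : M|) ->
    p^'.-Hall(der_power G p) X ->
  X <| G.
Proof.
set D := der_power_group G p; move=> solG p_pr primeM hallX.
have nsDG: D <| G := der_power_normal G p; have sDG := normal_sub nsDG.
have [sXD p'X pDX] := and3P hallX; have sXG := subset_trans sXD sDG.
have defG := Hall_Frattini_arg (solvableS sDG solG) nsDG hallX.
have [eqN | [M maxM sNM]] := maximal_exists (subsetIl G 'N(X)).
  by rewrite /normal sXG -{1}eqN subsetIr.
have sXM: X \subset M by rewrite (subset_trans _ sNM) // subsetI sXG normG.
have prop L : L \subset M -> L * 'N_G(X) = G -> False.
  move=> sLM eqG; have:= maxgroupp maxM.
  by rewrite -eqG properE mul_subG ?andbF.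
have defMD: M * D = G.
  apply: mulg_maximal_normal => //; apply/negP=> sDM.
  exact: prop sDM defG.
have idxM: #|G : M| = p.
  apply/eqP; have: #|G : M| %| #|D : X|.
    by rewrite (index_mulg_eq sDG defMD) indexgS // subsetI sXM.
  by move/(pnat_dvd)/(_ pDX); rewrite pnatE ?primeM // negnK.
have [V [nsVG sMVK sG'V powV]] :=
  maximal_prime_index_socle solG maxM (primeM M maxM).
pose E := (D :&: gcore M G)%G.
have sDV: D \subset V.
  rewrite gen_subG subUset sG'V /=.
  by apply/subsetP=> _ /imsetP[x Gx ->]; rewrite -idxM powV.
have sXE: X \subset E.
  rewrite subsetI sXD (subset_trans _ sMVK) // subsetI sXM.
  exact: subset_trans sXD sDV.
have nsEG: E <| G by rewrite normalI ?gcore_normal ?maximal_sub.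
have sEG := normal_sub nsEG.
have hallXE := pHall_subl sXE (subsetIl _ _) hallX.
have := Hall_Frattini_arg (solvableS sEG solG) nsEG hallXE.
case/prop; exact: subset_trans (subsetIr _ _) (gcore_sub _ _).
Qed.

(** The normal Hall [p^']-subgroup of [der_power G p] centralises the
    [p]-group [N], and a Sylow [p]-subgroup of [der_power G p] centralises a
    nontrivial subgroup of [N]. So the centraliser of [der_power G p] in [N]
    is not trivial, and it is normal in [G]. *)
Lemma der_power_cent_minnormal G p N :
    solvable G -> prime p -> (forall M, maximal M G -> prime #|G : M|) ->
    minnormal N G -> p.-group N -> N \subset G ->
  der_power G p \subset 'C(N).
Proof.
set D := der_power_group G p; move=> solG p_pr primeM minN pN sNG.
have /andP[ntN nNG] := mingroupp minN; have [_ minN'] := mingroupP minN.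
have nsDG: D <| G := der_power_normal G p; have sDG := normal_sub nsDG.
have [X hallX] := Hall_exists p^' (solvableS sDG solG).
have [P sylP] := Sylow_exists p D.
have [sXD p'X _] := and3P hallX; have [sPD pP _] := and3P sylP.
have nsXG := Hall_der_power_normal solG p_pr primeM hallX.
have tiXN: X :&: N = 1 by rewrite setIC coprime_TIg // (pnat_coprime pN).
have cXN: X \subset 'C(N).
  rewrite (sameP commG1P trivgP) -tiXN subsetI commg_subl commg_subr.
  rewrite (subset_trans sNG (normal_norm nsXG)) /=.
  exact: subset_trans (normal_sub nsXG) nNG.
have defD: P * X = D.
  apply/eqP; rewrite eqEcard mul_subG // TI_cardMg.
    by rewrite (card_Hall sylP) (card_Hall hallX) partnC ?cardG_gt0 //= leqnn.
  by rewrite coprime_TIg // (pnat_coprime pP).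
have nNP: P \subset 'N(N) by rewrite (subset_trans sPD) ?(subset_trans sDG).
have ntZ: N :&: 'Z(N <*> P) != 1.
  have pNP: p.-group (N <*> P) by rewrite norm_joinEr // pgroupM pN.
  apply: meet_center_nil (pgroup_nil pNP) _ ntN.
  by rewrite /normal joing_subl join_subG normG.
have ntC: 'C_N(D) != 1.
  apply: contra ntZ; rewrite -!subG1; apply: subset_trans.
  rewrite subsetI subsetIl -defD /= centM subsetI; apply/andP; split.
    by rewrite subIset // orbC /center subIset // centS ?orbT ?joing_subr.
  by rewrite subIset // centsC cXN.
rewrite centsC -(minN' 'C_N(D)%G); first exact: subsetIr.
  by rewrite ntC normsI // norms_cent // normal_norm.
exact: subsetIl.
Qed.

Lemma maximal_prime_index_minnormal G N :
    solvable G -> (forall M, maximal M G -> prime #|G : M|) ->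
    minnormal N G -> N \subset G ->
  prime #|N|.
Proof.
move=> solG primeM minN sNG.
have [_ ntN /is_abelemP[p p_pr abelN]] := minnormal_solvable minN sNG solG.
have pN := abelem_pgroup abelN.
have cND := der_power_cent_minnormal solG p_pr primeM minN pN sNG.
rewrite (minnormal_abelian_action_prime p_pr pN minN) //.
  by apply: subset_trans cND; rewrite (subset_trans _ (subset_gen _)) ?subsetUl.
by move=> x Gx; apply: (subsetP cND); apply: mem_der_power.
Qed.

End Supersolvable.

Section SupersolvableSeries.

Variable gT : finGroupType.
Implicit Types G H K L M N P Q R V : {group gT}.

Definition supersolvable_step G : rel {group gT} :=
  [rel K L : {group gT} | [&& L <| G, K \subset L & cyclic (L / K)]].

Lemma supersolvable_path_solvable G K s :
    K <| G -> solvable K -> path (supersolvable_step G) K s ->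
  solvable (last K s).
Proof.
elim: s K => //= L s IHs K nsKG solK /andP[/and3P[nsLG sKL cycLK]].
apply: IHs => //.
rewrite (series_sol (normalS sKL (normal_sub nsLG) nsKG)) solK.
exact: abelian_sol (cyclic_abelian cycLK).
Qed.

Lemma supersolvable_solvable G : supersolvable G -> solvable G.
Proof.
case=> s pathG <-; apply: supersolvable_path_solvable pathG.
  exact: normal1.
exact: solvable1.
Qed.

(** All the subgroups between [K] and [L] are normal in [G]. Let [D] be
    [M :&: L], and [X] be such that [X / D] is a subgroup of prime order of
    [L / D]. Then [M * X] is [G], so that the index of [M] is that of [D] in
    [X]. *)
Lemma supersolvable_step_maximal_index G K L M :
    K <| G -> K \subset M -> supersolvable_step G K L -> maximal M G ->
    ~~ (L \subset M) ->
  prime #|G : M|.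
Proof.
move=> nsKG sKM /and3P[nsLG sKL cycLK] maxM notLM.
have sMG := maximal_sub maxM; have sLG := normal_sub nsLG.
have nsX (X : {group gT}) : K \subset X -> X \subset L -> X <| G.
  move=> sKX sXL; have sXG := subset_trans sXL sLG.
  rewrite -(quotientGK nsKG) -(quotientGK (normalS sKX sXG nsKG)).
  rewrite cosetpre_normal.
  apply: char_normal_trans (quotient_normal K nsLG).
  by rewrite sub_cyclic_char // quotientS.
pose D := (M :&: L)%G.
have sKD: K \subset D by rewrite subsetI sKM.
have sDL: D \subset L := subsetIr M L.
have nsDG: D <| G by apply: nsX.
have nsDL := normalS sDL sLG nsDG.
have LD_gt1: 1 < #|L / D|.
  rewrite card_quotient ?normal_norm // indexg_gt1.
  by apply: contra notLM => sLD; apply: subset_trans sLD (subsetIl _ _).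
have [x LDx ox] := Cauchy (pdiv_prime LD_gt1) (pdiv_dvd _).
have sxL: <[x]> \subset L / D by rewrite cycle_subG.
have [X defX sDX sXL] := inv_quotientS nsDL sxL.
have nsXG := nsX X (subset_trans sKD sDX) sXL.
have idxX: #|X : D| = #[x].
  by rewrite -card_quotient ?(subset_trans sXL) ?normal_norm // -defX.
have idx_pr: prime #|X : D| by rewrite idxX ox pdiv_prime.
have notXM: ~~ (X \subset M).
  apply: contraL idx_pr => sXM.
  by rewrite (_ : #|X : D| = 1%N) //; apply/eqP; rewrite indexg_eq1 subsetI sXM.
have defG := mulg_maximal_normal maxM nsXG notXM.
rewrite (index_mulg_eq (normal_sub nsXG) defG).
have -> : M :&: X = D; last exact: idx_pr.
by apply/eqP; rewrite eqEsubset setIS //= subsetI subsetIl.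
Qed.

Lemma supersolvable_maximal_index G M :
  supersolvable G -> maximal M G -> prime #|G : M|.
Proof.
case=> s pathG lastG maxM.
suff: forall K, K <| G -> K \subset M -> path (supersolvable_step G) K s ->
    last K s = G -> prime #|G : M|.
  by move/(_ 1%G (normal1 G) (sub1G M) pathG lastG).
elim: s {pathG lastG} => [K _ sKM _ /= eqKG | L s IHs K nsKG sKM /=].
  by have:= maxgroupp maxM; rewrite -eqKG properE sKM andbF.
case/andP=> stepKL pathL lastL; have [sLM | notLM] := boolP (L \subset M).
  by apply: IHs pathL lastL => //; case/and3P: stepKL.
exact: supersolvable_step_maximal_index nsKG sKM stepKL maxM notLM.
Qed.

End SupersolvableSeries.

Lemma cosetpre_supersolvable_path (gT : finGroupType) (G N : {group gT})
    (K : {group coset_of N}) s :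
    N <| G -> K <| G / N -> path (supersolvable_step (G / N)%G) K s ->
  path (supersolvable_step G) (coset N @*^-1 K)%G
       [seq (coset N @*^-1 (L : {group coset_of N}))%G | L <- s].
Proof.
move=> nsNG; elim: s K => //= L s IHs K nsK /andP[/and3P[nsL sKL cycLK] pathL].
rewrite (IHs L) // andbT; apply/and3P.
have preG (X : {group coset_of N}) : X <| G / N -> coset N @*^-1 X <| G.
  by move=> nsX; rewrite -[G in _ <| G](quotientGK nsNG) cosetpre_normal.
split; first exact: preG.
  by rewrite /= cosetpreSK.
have sNpre (X : {group coset_of N}) : N \subset coset N @*^-1 X.
  by rewrite -{1}ker_coset morphpreS ?sub1G.
have nsKL := normalS sKL (normal_sub nsL) nsK.
have nsNL : N <| coset N @*^-1 L.
  exact: normalS (sNpre L) (normal_sub (preG L nsL)) nsNG.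
have nsKLpre : coset N @*^-1 K <| coset N @*^-1 L by rewrite cosetpre_normal.
rewrite -(isog_cyclic (third_isog (sNpre K) nsNL nsKLpre)).
by rewrite /= !cosetpreK.
Qed.

(** This is Huppert's theorem for solvable groups, by induction: a minimal
    normal subgroup has prime order. *)
Lemma maximal_prime_index_supersolvable (gT : finGroupType) (G : {group gT}) :
    solvable G -> (forall M : {group gT}, maximal M G -> prime #|G : M|) ->
  supersolvable G.
Proof.
have [n] := ubnP #|G|; elim: n gT G => // n IHn gT G /ltnSE-leGn solG primeM.
have [G1 | ntG] := eqVneq (G : {set gT}) 1.
  by exists [::] => //=; apply/esym/val_inj.
have [N minN sNG] := minnormal_exists ntG (normG G).
have /andP[ntN nNG] := mingroupp minN; have nsNG: N <| G by apply/andP.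
have N_pr := maximal_prime_index_minnormal solG primeM minN sNG.
have [||Mb maxM|s path_s last_s] := IHn _ (G / N)%G.
- by rewrite (leq_trans (ltn_quotient ntN sNG)).
- exact: quotient_sol.
- have [M defM sNM sMG] := inv_quotientS nsNG (maximal_sub maxM).
  rewrite /= defM index_quotient_eq ?normal_norm // ?subIset ?sNM ?orbT //.
  apply: primeM; rewrite -(quotient_maximal (normalS sNM sMG nsNG) nsNG).
  by rewrite -defM.
have := cosetpre_supersolvable_path nsNG (normal1 _) path_s.
have preN1: (coset N @*^-1 1)%G = N by apply/val_inj; apply: ker_coset.
rewrite preN1.
set s' := map _ s => path_s'; exists (N :: s').
  rewrite /= path_s' andbT nsNG sub1G /=.
  by rewrite -(isog_cyclic (quotient1_isog N)) prime_cyclic.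
rewrite /= -preN1 /s' last_map last_s; apply/val_inj; exact: quotientGK.
Qed.

(** By Huppert's theorem, supersolvability can be read from the indices of the
    maximal subgroups. *)
Theorem maximal_bijection_supersolvable (gT hT : finGroupType)
    (G : {group gT}) (H : {group hT}) f :
  maximal_bijection G H f -> supersolvable G -> supersolvable H.
Proof.
move=> fP superG; have [injf _ maxf] := fP.
apply: maximal_prime_index_supersolvable => [|M maxM].
  exact: maximal_bijection_solvable fP (supersolvable_solvable superG).
have [L maxL defM] := maximal_bijection_lift fP maxM.
have [sLG sMH] := (maximal_sub maxL, maximal_sub maxM).
rewrite -divgS // -(maximal_bijection_card fP) -defM (card_imset_on injf sLG).
by rewrite divgS //; apply: supersolvable_maximal_index superG maxL.
Qed.

(** * Vertices of the components as words *)

Section Words.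

Variables (gT : finGroupType) (G : {group gT}).
Implicit Types (i : Lambda_index G) (s t : seq gT).

Definition generating s := <<[set z in s]>> == G.

(** The tuples that are vertices of [Gamma_star G a b]; the condition on the
    length of [s] is part of the condition on the pair [s], [t]. *)
Definition nonisolated_word a b s :=
  (all [in G] s : Prop) /\ exists t, [/\ (all [in G] t : Prop),
    ((size s == a) && (size t == b) || (size s == b) && (size t == a) : Prop)
    & generating (s ++ t)].

Definition star_word a b (u : vert (Gamma_star G a b)) : seq gT :=
  val (sval (sval u)).

Definition word i (x : vert (Lambda_graph i)) : seq gT := star_word (sval x).

Lemma word_inj i : injective (@word i).
Proof. by move=> x y eq_xy; do 4![apply: val_inj]. Qed.

Lemma adj_star_word a b (u v : vert (Gamma_star G a b)) :
  adj u v =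
    ((size (star_word u) == a) && (size (star_word v) == b)
     || (size (star_word u) == b) && (size (star_word v) == a))
    && generating (star_word u ++ star_word v).
Proof. by []. Qed.

Lemma adj_word i (x y : vert (Lambda_graph i)) :
  adj x y =
    ((size (word x) == Lambda_a i) && (size (word y) == Lambda_b i)
     || (size (word x) == Lambda_b i) && (size (word y) == Lambda_a i))
    && generating (word x ++ word y).
Proof. exact: adj_star_word. Qed.

Lemma star_wordP a b (u : vert (Gamma_star G a b)) :
  ((size (star_word u) == a) || (size (star_word u) == b))
  /\ nonisolated_word a b (star_word u).
Proof.
case: u => -[s sP] /= nis; rewrite /star_word /=; have/andP[sz sub] := sP.
split=> //; split=> //; move: nis; rewrite inE negb_forall.
case/existsP=> -[t tP]; rewrite negbK => /andP[szt gen].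
by exists t; split=> //; have /andP[] := tP.
Qed.

Lemma word_nonisolated i (x : vert (Lambda_graph i)) :
  nonisolated_word (Lambda_a i) (Lambda_b i) (word x).
Proof. by case: (star_wordP (sval x)). Qed.

Lemma word_sub i (x : vert (Lambda_graph i)) : all [in G] (word x).
Proof. by case: (word_nonisolated x). Qed.

Lemma size_word i (x : vert (Lambda_graph i)) :
  (size (word x) == Lambda_a i) || (size (word x) == Lambda_b i).
Proof. by case: (star_wordP (sval x)). Qed.

(** A word of the prescribed length [n] generating [K], as soon as [n] is at
    least the order of [K]. *)
Definition gen_word (K : {set gT}) n := enum K ++ nseq (n - #|K|) 1.

Lemma size_gen_word (K : {set gT}) n : #|K| <= n -> size (gen_word K n) = n.
Proof. by move=> leKn; rewrite size_cat size_nseq -cardE subnKC. Qed.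

Lemma set_gen_word (K : {group gT}) n : [set z in gen_word K n] = K.
Proof.
apply/setP=> z; rewrite inE mem_cat mem_enum mem_nseq.
by case Kz: (z \in K) => //=; apply: contraFF Kz => /andP[_ /eqP->].
Qed.

Lemma all_gen_word (K : {group gT}) n :
  K \subset G -> all [in G] (gen_word K n).
Proof.
move=> sKG; apply/allP=> z Kz; apply: (subsetP sKG).
by rewrite -(set_gen_word K n) inE.
Qed.

Lemma sub_generating s t :
  generating s -> all [in G] t -> {subset s <= t} -> generating t.
Proof.
move=> /eqP gen_s /allP sub_t sub_st; rewrite /generating eqEsubset.
rewrite gen_subG -gen_s genS ?andbT.
  by rewrite gen_s; apply/subsetP=> z; rewrite inE; apply: sub_t.
by apply/subsetP=> z; rewrite !inE; apply: sub_st.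
Qed.

Lemma gen_word_generating n : generating (gen_word G n).
Proof. by rewrite /generating set_gen_word genGid. Qed.

Lemma generating_rev s t : generating (s ++ t) = generating (t ++ s).
Proof.
congr (<<_>> == _); apply/setP=> z; rewrite !inE !mem_cat; exact: orbC.
Qed.

Lemma star_word_exists a b s :
    a <= b -> nonisolated_word a b s ->
  exists u : vert (Gamma_star G a b), star_word u = s.
Proof.
move=> le_ab [sub_s [t [sub_t sz gen]]].
have mkvert r : all [in G] r -> (size r == a) || (size r == b) ->
    exists v : Gamma_vert G a b, val (sval v) = r.
  move=> sub_r sz_r; have le_r: size r <= b by case/orP: sz_r => /eqP->.
  have rP: ((size (Bseq le_r) == a) || (size (Bseq le_r) == b))
      && all [in G] (Bseq le_r) by rewrite sz_r.
  by exists (exist _ (Bseq le_r) rP).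
have [|v def_s] := mkvert s sub_s.
  by case/orP: sz => /andP[-> _]; rewrite ?orbT.
have [|w def_t] := mkvert t sub_t.
  by case/orP: sz => /andP[_ ->]; rewrite ?orbT.
have nis: v \in [set x | ~~ isolated (X := Gamma G a b) x].
  rewrite inE negb_forall; apply/existsP; exists w; rewrite negbK.
  rewrite /= /Gamma_adj; apply/andP.
  by rewrite -def_s -def_t in sz gen.
by exists (exist _ v nis).
Qed.

(** When [b] is at least the order of [G], some word of length [b] generates
    [G]. It is adjacent to every word of length [a], and every other vertex is
    adjacent to a word of length [a]. *)
Lemma star_connected a b (u v : vert (Gamma_star G a b)) :
  a <= b -> #|G| <= b -> connect (@adj (Gamma_star G a b)) u v.
Proof.
move=> le_ab le_Gb.
have sub0 := all_gen_word b (subxx G); have gen0 := gen_word_generating b.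
have sz0 := size_gen_word le_Gb.
have gen_cat t : all [in G] t -> generating (t ++ gen_word G b).
  move=> sub_t; apply: sub_generating gen0 _ _.
    by rewrite all_cat sub_t sub0.
  by move=> z Gz; rewrite mem_cat Gz orbT.
have [|u0 def_u0] := @star_word_exists a b (gen_word G b) le_ab.
  split=> //; exists (nseq a 1); split.
  - by apply/allP=> z /nseqP[-> _].
  - by rewrite sz0 size_nseq !eqxx orbT.
  by rewrite generating_rev gen_cat //; apply/allP=> z /nseqP[-> _].
have symG: connect_sym (@adj (Gamma_star G a b)).
  by apply: sym_connect_sym; apply: adj_sym.
have adj0 w : size (star_word w) == a -> connect (@adj (Gamma_star G a b)) w u0.
  move=> sz_w; apply: connect1; rewrite adj_star_word def_u0 sz_w sz0 eqxx /=.
  by rewrite gen_cat //; case: (star_wordP w) => _ [].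
suff conn0 w : connect (@adj (Gamma_star G a b)) w u0.
  by rewrite (connect_trans (conn0 u)) // symG.
have [/orP[/adj0 // | sz_w] [sub_w [t [sub_t sz gen]]]] := star_wordP w.
have [sz_wa | neq_wa] := eqVneq (size (star_word w)) a.
  by apply: adj0; rewrite sz_wa.
have sz_t: size t == a by move: sz; rewrite (negPf neq_wa) => /andP[].
have [|x def_x] := @star_word_exists a b t le_ab.
  split=> //; exists (star_word w); split; rewrite // 1?generating_rev //.
  by rewrite sz_t sz_w.
apply: connect_trans (adj0 x _); last by rewrite def_x.
by apply: connect1; rewrite adj_star_word def_x sz_w sz_t gen orbT.
Qed.

Lemma word_exists i s :
    #|G| <= Lambda_b i -> nonisolated_word (Lambda_a i) (Lambda_b i) s ->
  exists x : vert (Lambda_graph i), word x = s.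
Proof.
move=> le_Gb /(star_word_exists (Lambda_leq i))[u def_u].
have Cu: u \in Lambda_comp i.
  have /imsetP[v _ ->] := Lambda_compP i.
  by rewrite inE star_connected // Lambda_leq.
by exists (exist _ u Cu).
Qed.

Lemma Lambda_index_exists a b :
    a <= b -> #|G| <= b ->
  exists i : Lambda_index G, Lambda_a i = a /\ Lambda_b i = b.
Proof.
move=> le_ab le_Gb; have [|u _] := @star_word_exists a b (gen_word G b) le_ab.
  split; first exact: all_gen_word.
  exists (nseq a 1); split; first by apply/allP=> z /nseqP[-> _].
    by rewrite size_gen_word // size_nseq !eqxx orbT.
  apply: sub_generating (gen_word_generating b) _ _.
    by rewrite all_cat all_gen_word //; apply/allP=> z /nseqP[-> _].
  by move=> z Gz; rewrite mem_cat Gz.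
have uP: [set v | connect (@adj (Gamma_star G a b)) u v]
    \in components (Gamma_star G a b) by apply: imset_f.
by exists (LambdaIndex le_ab uP).
Qed.

End Words.

Section Counting.

Variables (gT : finGroupType) (G : {group gT}).
Implicit Types (i : Lambda_index G) (s t : seq gT).

Definition side i n := [set x : vert (Lambda_graph i) | size (word x) == n].

Lemma all_nseq1 n : all [in G] (nseq n 1).
Proof. by apply/allP=> z /nseqP[-> _]. Qed.

Lemma nonisolated_left a b s : #|G| <= b -> all [in G] s -> size s = a ->
  nonisolated_word G a b s.
Proof.
move=> le_Gb sub_s sz_s; split=> //; exists (gen_word G b).
rewrite sz_s size_gen_word // !eqxx all_gen_word //; split=> //.
apply: sub_generating (gen_word_generating G b) _ _.
  by rewrite all_cat sub_s all_gen_word.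
by move=> z Gz; rewrite mem_cat Gz orbT.
Qed.

Lemma nonisolated_generating a b s : all [in G] s -> size s = b ->
  generating G s -> nonisolated_word G a b s.
Proof.
move=> sub_s sz_s gen_s; split=> //; exists (nseq a 1).
rewrite sz_s size_nseq !eqxx orbT all_nseq1; split=> //.
apply: sub_generating gen_s _ _; first by rewrite all_cat sub_s all_nseq1.
by move=> z Gz; rewrite mem_cat Gz.
Qed.

(** A list of the elements of [G] can be extended to length [Lambda_b i] by [k]
    copies of some [x] other than [1] followed by copies of [1], with as many
    choices of [k]. *)
Lemma card_right_side i :
    G :!=: 1 -> #|G| <= Lambda_b i ->
  Lambda_b i - #|G| <= #|side i (Lambda_b i)|.
Proof.
set b := Lambda_b i => /trivgPn[x Gx ntx] le_Gb; set m := b - #|G|.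
pose s k := enum G ++ nseq k x ++ nseq (m - k) 1.
have sz_s k : k < m -> size (s k) = b.
  by move=> lt_k; rewrite !size_cat !size_nseq -cardE subnKC ?subnKC // ltnW.
have sub_s k : all [in G] (s k).
  rewrite !all_cat all_nseq1 andbT; apply/andP; split.
    by apply/allP=> z; rewrite mem_enum.
  by apply/allP=> z /nseqP[-> _].
have gen_s k : generating G (s k).
  apply: sub_generating (gen_word_generating G #|G|) (sub_s k) _ => z.
  by rewrite !mem_cat subnn => /orP[-> //|].
have /fin_all_exists[f fP] (k : 'I_m) :
    exists y : vert (Lambda_graph i), word y = s k.
  by apply: word_exists => //; apply: nonisolated_generating; rewrite ?sz_s.
have injf: injective f.
  move=> k l eq_kl; apply: val_inj => /=.
  have: count (pred1 x) (s k) = count (pred1 x) (s l) by rewrite -!fP eq_kl.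
  rewrite !count_cat !count_nseq /= eqxx [1 == x]eq_sym (negPf ntx).
  by rewrite !mul0n !mul1n !addn0 => /addnI.
rewrite -[m]card_ord -(card_imset _ injf) subset_leq_card //.
by apply/subsetP=> _ /imsetP[k _ ->]; rewrite inE fP sz_s.
Qed.

Lemma card_left_side i :
  #|G| <= Lambda_b i -> #|side i (Lambda_a i)| = (#|G| ^ Lambda_a i)%N.
Proof.
move=> le_Gb; set a := Lambda_a i.
have subt (t : a.-tuple (subg_of G)) : all [in G] (map val t).
  by apply/allP=> _ /mapP[z _ ->]; apply: subgP.
have /fin_all_exists[f fP] (t : a.-tuple (subg_of G)) :
    exists x : vert (Lambda_graph i), word x = map val t.
  apply: word_exists (nonisolated_left _ _ _) => //.
  by rewrite size_map size_tuple.
have injf: injective f.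
  move=> t u eq_tu; apply/val_inj/(inj_map val_inj).
  by rewrite -!fP eq_tu.
have cardG: #|{: subg_of G}| = #|G| by rewrite card_sub; apply: eq_card.
rewrite -cardG -card_tuple -(card_imset _ injf); apply: eq_card => x.
rewrite inE; apply/idP/imsetP=> [sz_x | [t _ ->]]; last first.
  by rewrite fP size_map size_tuple.
have sz_t: size (map (subg G) (word x)) == a by rewrite size_map.
exists (Tuple sz_t) => //; apply: word_inj; rewrite fP /= -map_comp.
rewrite -[LHS]map_id; apply/eq_in_map=> z xz /=.
by rewrite subgK //; apply: (allP (word_sub x)).
Qed.

(** So a graph with many vertices can only occur for large [Lambda_b i]. *)
Lemma card_vert_le i n :
  Lambda_b i <= n -> #|vert (Lambda_graph i)| <= #|{: n.-bseq gT}|.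
Proof.
move=> le_bn; pose f (x : vert (Lambda_graph i)) : n.-bseq gT :=
  insubd (nil_bseq n gT) (word x).
have fP x : val (f x) = word x.
  rewrite /f val_insubd; case: ifP => // /negP[].
  rewrite (leq_trans _ le_bn) //; case/orP: (size_word x) => /eqP-> //.
  exact: Lambda_leq.
apply: (leq_card f) => x y eq_xy; apply: word_inj; by rewrite -!fP eq_xy.
Qed.

Lemma card_vert_triv i : G :=: 1 -> #|vert (Lambda_graph i)| <= 2.
Proof.
move=> G1; rewrite -card_bool.
apply: (leq_card (fun x => size (word x) == Lambda_a i)).
have word1 (x : vert (Lambda_graph i)) : word x = nseq (size (word x)) 1.
  apply/all_pred1P; apply: sub_all (word_sub x) => z /=.
  by rewrite G1 => /set1P->.
move=> x y eq_xy; apply: word_inj; rewrite (word1 x) (word1 y); congr nseq.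
move: eq_xy (size_word x) (size_word y).
case: eqP => [-> /esym/eqP-> // | _ /esym-> /= /eqP-> /eqP->]; exact: erefl.
Qed.

End Counting.
(** * Components of large graphs *)

Lemma graph_iso_sym X Y : graph_iso X Y -> graph_iso Y X.
Proof.
case=> f [g fK gK] adj_f; exists g => [|x y]; first by exists f.
by rewrite -adj_f !gK.
Qed.

Lemma same_Lambda_sym (gT hT : finGroupType) (G : {group gT}) (H : {group hT}) :
  same_Lambda G H -> same_Lambda H G.
Proof.
case=> f [g fK gK] iso_f; exists g => [|i]; first by exists f.
by apply: graph_iso_sym; rewrite -{2}[i]gK.
Qed.

Section LargeComponents.

Variables (gT hT : finGroupType) (G : {group gT}) (H : {group hT}).

(** Because of the bounds on [Lambda_b], this is an isomorphism between the
    whole of [Gamma_star G 1 b] and the whole of [Gamma_star H a' b'], which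
    maps the words of length [1] to the words of length [a']. *)
Definition sided_iso (i : Lambda_index G) (j : Lambda_index H)
    (F : vert (Lambda_graph i) -> vert (Lambda_graph j)) :=
  [/\ [/\ Lambda_a i = 1%N, 1 < Lambda_b i & #|G| <= Lambda_b i],
      Lambda_a j < Lambda_b j /\ #|H| <= Lambda_b j,
      bijective F, forall x y, adj (F x) (F y) = adj x y
    & forall x, (size (word (F x)) == Lambda_a j) = (size (word x) == 1%N)].

Lemma adj_size_neq (kT : finGroupType) (K : {group kT}) (i : Lambda_index K)
    (x y : vert (Lambda_graph i)) :
    Lambda_a i < Lambda_b i -> adj x y ->
  (size (word x) == Lambda_a i) = (size (word y) != Lambda_a i).
Proof.
move=> lt_ab; rewrite adj_word.
by case/andP=> /orP[] /andP[/eqP-> /eqP->]; rewrite eqxx gtn_eqF.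
Qed.

(** Take [b] so large that the image of [Gamma_star G 1 b] has too many vertices
    for its own [b'] to be small; then it is the whole of [Gamma_star H a' b'],
    and [a'] differs from [b'] because there are no loops. A connected
    bipartite graph has only two proper colourings, and that by length has
    few words of length [1] on one side, but many words of length [b'] on the
    other: so the two colourings by length agree. *)
Lemma same_Lambda_sided_iso :
    G :!=: 1 -> same_Lambda G H ->
  exists i, exists j, exists2 F,
    @sided_iso i j F & #|G| = (#|H| ^ Lambda_a j)%N.
Proof.
move=> ntG [f _ isof].
(* If [b'] were at most [m], the image would have fewer than [B] vertices,
   while [Gamma_star G 1 (#|G| + B)] has at least [B] of them; and [B] is more
   than [2] in order to exclude a trivial [H]. Being more than [m], [b'] is at
   least [#|H|], and there are more than [#|G|] vertices of length [b']. *)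
pose m := (#|H| + #|G|)%N; pose B := (#|{: m.-bseq hT}|).+3.
have [||i [ai bi]] := @Lambda_index_exists _ G 1%N (#|G| + B).
- by rewrite addnS.
- exact: leq_addr.
have b_gt1 : 1 < Lambda_b i by rewrite bi !addnS.
have le_Gb : #|G| <= Lambda_b i by rewrite bi leq_addr.
have [F bijF adjF] := isof i; move: (f i) F bijF adjF => j F bijF adjF {f isof}.
have leBvert : B <= #|vert (Lambda_graph j)|.
  rewrite -(bij_eq_card bijF) (leq_trans _ (max_card (side i (Lambda_b i)))) //.
  by rewrite (leq_trans _ (card_right_side ntG le_Gb)) // bi addKn.
have lt_mb : m < Lambda_b j.
  rewrite ltnNge; apply: contraL leBvert => /card_vert_le le_vB.
  by rewrite -ltnNge ltnS !leqW.
have ntH : H :!=: 1.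
  apply: contraTneq leBvert => H1; rewrite -ltnNge.
  by apply: leq_ltn_trans (card_vert_triv j H1) _; rewrite /B !ltnS.
have le_Hb : #|H| <= Lambda_b j by rewrite (leq_trans _ (ltnW lt_mb)) ?leq_addr.
have lt_i : Lambda_a i < Lambda_b i by rewrite ai.
have lt_j : Lambda_a j < Lambda_b j.
  rewrite ltn_neqAle Lambda_leq andbT; apply/eqP=> eq_ab.
  have [|y def_y] := @word_exists _ _ j (gen_word H (Lambda_b j)) le_Hb.
    by apply: nonisolated_left; rewrite ?all_gen_word ?size_gen_word.
  have loop_y : adj y y.
    rewrite adj_word def_y size_gen_word // eq_ab eqxx /=.
    apply: sub_generating (gen_word_generating H (Lambda_b j)) _ _.
      by rewrite all_cat andbb all_gen_word.
    by move=> z Hz; rewrite mem_cat Hz.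
  have [F' _ F'K] := bijF; move: loop_y.
  rewrite -[y]F'K adjF => /(adj_size_neq lt_i).
  by case: (_ == _).
have [|x0 def_x0] := @word_exists _ _ i (gen_word G (Lambda_b i)) le_Gb.
  apply: nonisolated_generating; last exact: gen_word_generating.
    exact: all_gen_word.
  exact: size_gen_word.
have sz_x0: size (word x0) = Lambda_b i by rewrite def_x0 size_gen_word.
(* [e] compares the two colourings; it is constant by connectedness. *)
pose e x := (size (word (F x)) == Lambda_a j) == (size (word x) == Lambda_a i).
have adj_e x y : adj x y -> e x = e y.
  move=> adj_xy; have := adj_xy; rewrite -adjF => /(adj_size_neq lt_j) eqF.
  by rewrite /e eqF (adj_size_neq lt_i adj_xy); do 2!case: (size _ == _).
have left_e x : size (word x) = Lambda_a i -> e x = e x0.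
  move=> sz_x; apply: adj_e; rewrite adj_word sz_x sz_x0 !eqxx /= def_x0.
  apply: sub_generating (gen_word_generating G (Lambda_b i)) _ _.
    by rewrite all_cat word_sub all_gen_word.
  by move=> z Gz; rewrite mem_cat Gz orbT.
have const_e x : e x = e x0.
  have [/left_e // | neq_x] := eqVneq (size (word x)) (Lambda_a i).
  have [_ [t [sub_t /orP[]]]] := word_nonisolated x; rewrite ?(negPf neq_x) //.
  case/andP=> sz_x /eqP sz_t gen.
  have [|y def_y] := @word_exists _ _ i t le_Gb; first exact: nonisolated_left.
  rewrite (adj_e x y); first by rewrite left_e ?def_y.
  by rewrite adj_word def_y sz_x sz_t eqxx gen orbT.
have injF := bij_inj bijF.
(* Otherwise [F] would match words of length [b'] with words of length [1]. *)
have e0 : e x0.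
  apply: contraLR (lt_mb) => ne0; rewrite -leqNgt.
  have: #|side j (Lambda_b j)| <= #|side i (Lambda_a i)|.
    rewrite -(card_imset (side i _) injF) subset_leq_card //.
    have [F' _ F'K] := bijF; apply/subsetP=> y; rewrite inE => /eqP sz_y.
    apply/imsetP; exists (F' y); rewrite ?F'K // inE.
    have := const_e (F' y); rewrite (negPf ne0) /e F'K sz_y gtn_eqF //.
    by case: (size _ == _).
  rewrite card_left_side // ai expn1.
  by move/(leq_trans (card_right_side ntH le_Hb)); rewrite leq_subLR.
exists i, j, F.
  split=> // x; first by rewrite -ai; have := const_e x; rewrite e0 => /eqP.
rewrite -card_left_side // -[LHS]expn1 -{1}ai -card_left_side //.
rewrite -(card_imset (side i _) injF); apply: eq_card => y.
have [F' _ F'K] := bijF.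
rewrite -[y]F'K (mem_imset _ _ injF) !inE.
by have := const_e (F' y); rewrite e0 => /eqP->.
Qed.

End LargeComponents.

Lemma same_Lambda_nontriv (gT hT : finGroupType) (G : {group gT})
    (H : {group hT}) :
  same_Lambda G H -> G :!=: 1 -> H :!=: 1.
Proof.
move=> sameL ntG; have [i [j [F _ oG]]] := same_Lambda_sided_iso ntG sameL.
by apply: contraNneq ntG => H1; rewrite trivg_card1 oG H1 cards1 exp1n.
Qed.

(** By symmetry the orders of [G] and [H] are powers of each other. *)
Lemma same_Lambda_sided_iso1 (gT hT : finGroupType) (G : {group gT})
    (H : {group hT}) :
    G :!=: 1 -> same_Lambda G H ->
  #|G| = #|H| /\ exists i, exists j, exists2 F,
    @sided_iso _ _ G H i j F & Lambda_a j = 1%N.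
Proof.
move=> ntG sameL; have ntH := same_Lambda_nontriv sameL ntG.
have [i [j [F isoF oG]]] := same_Lambda_sided_iso ntG sameL.
have [_ [j' [_ _ oH]]] := same_Lambda_sided_iso ntH (same_Lambda_sym sameL).
move: ntG ntH; rewrite -!cardG_gt1 => G_gt1 H_gt1.
have a_gt0: 0 < Lambda_a j.
  by rewrite lt0n; apply: contraTneq G_gt1 => a0; rewrite oG a0.
have a'_gt0: 0 < Lambda_a j'.
  by rewrite lt0n; apply: contraTneq H_gt1 => a0; rewrite oH a0.
have oGH: #|G| = #|H|.
  apply/anti_leq/andP; split.
    by rewrite oH -{1}[#|G|]expn1 leq_pexp2l ?cardG_gt0.
  by rewrite oG -{1}[#|H|]expn1 leq_pexp2l ?cardG_gt0.
split=> //; exists i, j, F => //; apply/eqP.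
by rewrite -(eqn_exp2l _ _ H_gt1) -oG oGH expn1.
Qed.
(** * Maximal subgroups as sets of non-neighbours *)

Section NonNeighbours.

Variables (gT : finGroupType) (G : {group gT}) (i : Lambda_index G).
Implicit Types (x y : vert (Lambda_graph i)) (M : {group gT}).

Hypotheses (ai : Lambda_a i = 1%N) (b_gt1 : 1 < Lambda_b i).
Hypothesis le_Gb : #|G| <= Lambda_b i.

(** The non-neighbours of [y] among the words of length one. *)
Definition nonnbr y := [set g in G | ~~ generating G (g :: word y)].

Definition nonnbr_sets := [set nonnbr y | y in [pred y | size (word y) != 1%N]].

Lemma nonnbr_maximal_sub g y :
  g \in nonnbr y -> exists2 M : {group gT}, maximal M G & M \subset nonnbr y.
Proof.
rewrite inE => /andP[Gg ngen].
have sub_gy h : h \in G -> <<[set z in h :: word y]>> \subset G.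
  move=> Gh; rewrite gen_subG; apply/subsetP=> z; rewrite !inE.
  by case/predU1P=> [-> // | ]; apply: (allP (word_sub y)).
have [eqG | [M maxM sub_M]] := maximal_exists (sub_gy g Gg).
  by case/negP: ngen; rewrite /generating eqG.
exists M => //; apply/subsetP=> h Mh.
have Gh := subsetP (maximal_sub maxM) h Mh.
rewrite inE Gh; apply: contraL (maxgroupp maxM) => /eqP gen_hy.
rewrite properE -gen_hy gen_subG negb_and negbK; apply/orP; right.
apply/subsetP=> z; rewrite !inE => /predU1P[-> // | yz].
by rewrite (subsetP sub_M) // mem_gen // !inE yz orbT.
Qed.

Lemma maximal_nonnbr M : maximal M G -> (M : {set gT}) \in nonnbr_sets.
Proof.
move=> maxM; have sMG := maximal_sub maxM; have ltMG := maxgroupp maxM.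
have [_ [g Gg notMg]] := properP ltMG.
have le_Mb : #|M| <= Lambda_b i by rewrite (leq_trans _ le_Gb) ?subset_leq_card.
have sz := size_gen_word le_Mb; have sub_M := all_gen_word (Lambda_b i) sMG.
have gen_cons h : <<[set z in h :: gen_word M (Lambda_b i)]>> = <<h |: M>>.
  by rewrite set_cons set_gen_word.
have genE h : h \in G ->
    generating G (h :: gen_word M (Lambda_b i)) = (h \notin M).
- move=> Gh; rewrite /generating gen_cons; apply/eqP/idP=> [genG | notMh].
    apply: contraL ltMG => Mh; rewrite -genG properE negb_and negbK.
    by rewrite gen_subG subUset sub1set Mh subxx orbT.
  have sM : M \subset <<h |: M>> by rewrite sub_gen // subsetUr.
  have [|eqM|//] := sub_maximal_eq maxM sM.
    by rewrite gen_subG subUset sub1set Gh.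
  by case/negP: notMh; rewrite -eqM mem_gen // setU11.
have [|y def_y] := @word_exists _ _ i (gen_word M (Lambda_b i)) le_Gb.
  split=> //; exists [:: g]; rewrite /= Gg sz ai !eqxx orbT; split=> //.
  by rewrite generating_rev genE.
apply/imsetP; exists y; first by rewrite inE def_y sz gtn_eqF.
apply/setP=> h; rewrite inE def_y; case Gh: (h \in G).
  by rewrite genE // negbK.
by apply: contraFF Gh; apply: (subsetP sMG).
Qed.

(** The non-neighbours of [y] form the union of the maximal subgroups that
    contain [y], and this union is a given maximal subgroup [M] when [y]
    generates [M]. Hence the maximal subgroups are the minimal ones among the
    nonempty sets of non-neighbours. *)
Lemma maximal_minset (S : {set gT}) :
  maximal S G = minset (fun T => (T != set0) && (T \in nonnbr_sets)) S.
Proof.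
have ntM M : (M : {set gT}) != set0 by apply/set0Pn; exists 1; apply: group1.
have sub_max (T : {set gT}) : T != set0 -> T \in nonnbr_sets ->
    exists2 M : {group gT}, maximal M G & M \subset T.
- case/set0Pn=> g Tg /imsetP[y _ defT]; rewrite defT in Tg *.
  exact: nonnbr_maximal_sub Tg.
apply/idP/minsetP=> [maxS | [/andP[ntS famS] minS]].
  pose M := Group (maximal_group_set maxS); have maxM : maximal M G := maxS.
  split=> [|T /andP[ntT famT] sTS].
    by rewrite (ntM M) (maximal_nonnbr maxM).
  have [L maxL sLT] := sub_max T ntT famT; apply/eqP; rewrite eqEsubset sTS.
  have [_ maxL'] := maxgroupP maxL.
  have eqS : S = L := maxL' M (maxgroupp maxM) (subset_trans sLT sTS).
  by rewrite eqS.
have [M maxM sMS] := sub_max S ntS famS.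
by rewrite -(minS M) // ntM maximal_nonnbr.
Qed.

End NonNeighbours.

(** The isomorphism maps words of length one to words of length one, which
    defines [f] on the elements of [G]; it maps the non-neighbours of a vertex
    to the non-neighbours of its image, and maximal subgroups can be told from
    the sets of non-neighbours. *)
Lemma sided_iso_maximal_bijection (gT hT : finGroupType) (G : {group gT})
    (H : {group hT}) i j F :
    @sided_iso _ _ G H i j F -> Lambda_a j = 1%N -> #|G| = #|H| ->
  exists f, maximal_bijection G H f.
Proof.
case=> -[ai bi_gt1 le_Gb] [lt_j le_Hb] bijF adjF szF aj oGH.
rewrite aj in lt_j szF; have injF := bij_inj bijF.
have fE (g : gT) : exists h : hT, g \in G -> exists2 x : vert (Lambda_graph i),
    word x = [:: g] & word (F x) = [:: h].
  case Gg: (g \in G); last by exists 1.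
  have [|x def_x] := @word_exists _ _ i [:: g] le_Gb.
    by apply: nonisolated_left; rewrite ?ai //= Gg.
  have: size (word (F x)) == 1%N by rewrite szF def_x.
  case def_h: (word (F x)) => [|h []] // _.
  by exists h => _; exists x.
have [f fP] := fin_all_exists fE.
have injf: {in G &, injective f}.
  move=> g g' /fP[x def_x def_Fx] /fP[x' def_x' def_Fx'] eq_fg.
  have/injF eq_x : F x = F x' by apply: word_inj; rewrite def_Fx eq_fg.
  by move: def_x'; rewrite -eq_x def_x => -[].
have imf: f @: G = H.
  apply/eqP; rewrite eqEcard card_in_imset // oGH leqnn andbT.
  apply/subsetP=> _ /imsetP[g /fP[x _ def_Fx] ->].
  by have := word_sub (F x); rewrite def_Fx /= andbT.
have genF g y : g \in G -> size (word y) != 1%N ->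
    generating H (f g :: word (F y)) = generating G (g :: word y).
  move=> /fP[x def_x def_Fx] sz_y; have := adjF x y; rewrite !adj_word.
  have sz_b : size (word y) == Lambda_b i.
    by have := size_word y; rewrite ai (negPf sz_y).
  have sz_Fb : size (word (F y)) == Lambda_b j.
    by have := size_word (F y); rewrite aj szF (negPf sz_y).
  by rewrite def_x def_Fx sz_b sz_Fb ai aj.
have nonnbrF y : size (word y) != 1%N -> f @: nonnbr y = nonnbr (F y).
  move=> sz_y; apply/setP=> h; apply/imsetP/idP=> [[g] | ].
    rewrite inE => /andP[Gg ngen] ->; rewrite inE genF // ngen andbT.
    by rewrite -imf imset_f.
  rewrite inE -imf => /andP[/imsetP[g Gg ->] ngen]; exists g => //.
  by rewrite inE Gg -genF.
have nbS (y : vert (Lambda_graph i)) : nonnbr y \subset G.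
  by apply/subsetP=> g; rewrite inE => /andP[].
have famF (S : {set gT}) : S \subset G ->
    (f @: S \in nonnbr_sets j) = (S \in nonnbr_sets i).
- move=> sSG; apply/imsetP/imsetP=> -[y]; rewrite inE => sz_y defS; last first.
    by exists (F y); rewrite ?inE ?szF // defS nonnbrF.
  have [F' _ F'K] := bijF; rewrite -[y]F'K in sz_y defS; rewrite szF in sz_y.
  exists (F' y) => //; apply: (imset_inj_on injf) => //.
  by rewrite nonnbrF.
have sub_fam (T : {set hT}) : T \in nonnbr_sets j -> T \subset f @: G.
  case/imsetP=> y _ ->; rewrite imf.
  by apply/subsetP=> h; rewrite inE => /andP[].
exists f; split=> // S sSG.
rewrite (maximal_minset aj) // (maximal_minset ai) //.
have nt_f (T : {set gT}) : (f @: T != set0) = (T != set0) by rewrite imset_eq0.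
apply/minsetP/minsetP=> -[/andP[ntS famS] minS].
  rewrite nt_f in ntS; rewrite famF // in famS.
  split=> [|T /andP[ntT famT] sTS]; first by rewrite ntS.
  apply: (imset_inj_on injf) => //; first exact: subset_trans sSG.
  by apply: minS; rewrite ?imsetS // nt_f ntT famF // (subset_trans sTS).
rewrite nt_f ntS famF // famS; split=> // T /andP[ntT famT] sTS.
have defT := imset_preimset_on (sub_fam T famT).
rewrite -defT (minS (G :&: f @^-1: T)) //.
  by rewrite -nt_f -famF ?subsetIl // defT ntT.
apply/subsetP=> g; rewrite !inE => /andP[Gg Tfg].
by rewrite -(mem_imset_on injf sSG Gg) (subsetP sTS).
Qed.

Theorem same_Lambda_maximal_bijection (gT hT : finGroupType) (G : {group gT})
    (H : {group hT}) :
  same_Lambda G H -> exists f, maximal_bijection G H f.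
Proof.
move=> sameL; have [G1 | ntG] := eqVneq (G : {set gT}) 1; last first.
  have [oGH [i [j [F isoF aj]]]] := same_Lambda_sided_iso1 ntG sameL.
  exact: sided_iso_maximal_bijection isoF aj oGH.
have H1 : H :=: 1.
  apply/eqP; apply: contraTT (eqxx (1 : {set gT})) => ntH.
  by rewrite -{1}G1; apply: same_Lambda_nontriv (same_Lambda_sym sameL) ntH.
have no_max (kT : finGroupType) (S : {set kT}) : maximal S 1 = false.
  apply/negP=> maxS; pose M := Group (maximal_group_set maxS).
  by have := maxgroupp (maxS : maximal M 1); rewrite properE sub1G andbF.
exists (fun=> 1); split=> [x y | | S _].
- by rewrite G1 => /set1P-> /set1P->.
- by rewrite G1 H1 imset_set1.
by rewrite G1 H1 !no_max.
Qed.

Local Close Scope group_scope.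

Theorem corollary5p14 (gT hT : finGroupType) (G : {group gT}) (H : {group hT}) :
  same_Lambda G H ->
  [/\ solvable G <-> solvable H,
      supersolvable G <-> supersolvable H
    & forall p k : nat, prime p -> 0 < k ->
        nb_maximal_of_index G (p ^ k) = nb_maximal_of_index H (p ^ k)].
Proof.
move=> sameL; have [f fP] := same_Lambda_maximal_bijection sameL.
have [g gP] := same_Lambda_maximal_bijection (same_Lambda_sym sameL).
split.
- split; first exact: maximal_bijection_solvable fP.
  exact: maximal_bijection_solvable gP.
- split; first exact: maximal_bijection_supersolvable fP.
  exact: maximal_bijection_supersolvable gP.
by move=> p k _ _; apply: maximal_bijection_nb_maximal fP _.
Qed.
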